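(* Let $(X, \mu, T)$ be a probability measure-preserving system, and let $\mathscr{P}$ be a countable measurable partition of $(X, \mu)$. Let $p > 1$ and $f \in L^p(\mu)$. Then $$\lim_{n, k \to \infty} \mathbb{E} \left[ \frac{1}{k} \sum_{j = 0}^{k - 1} f \circ T^j \;\Big|\; \bigvee_{i = 0}^{n - 1} T^{-i}\mathscr{P} \right] = \mathbb{E} \left[ f \mid \mathfrak{I} \cap \mathfrak{P} \right] \quad \text{almost surely},$$ where $\mathfrak{I}$ is the $\sigma$-algebra of $T$-invariant measurable subsets of $X$, and $\mathfrak{P}$ is the $\sigma$-algebra generated by $\bigcup_{n = 1}^\infty \bigvee_{i = 0}^{n - 1} T^{-i} \mathscr{P}$.
   Context: A probability measure-preserving system $(X,\mu,T)$ consists of a probability space $(X,\mu)$ and a measurable map $T : X \to X$ with $\mu(T^{-1}E) = \mu(E)$ for all measurable $E$ ($T$ is not assumed invertible). $T^{-i}\mathscr{P} = \{T^{-i}P : P \in \mathscr{P}\}$, and $\bigvee_{i=0}^{n-1} T^{-i}\mathscr{P}$ is the common refinement of the partitions $\mathscr{P}, T^{-1}\mathscr{P}, \dots, T^{-(n-1)}\mathscr{P}$. The conditional expectation given a countable measurable partition means the conditional expectation given the $\sigma$-algebra it generates. The limit $\lim_{n,k\to\infty}$ is a joint (double) limit: for almost every $x$, for every $\epsilon>0$ there is $N$ such that the quantity is within $\epsilon$ of the limit whenever $n \geq N$ and $k \geq N$. *)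

(* Defs.v *)
From HB Require Import structures.
From mathcomp Require Export all_boot all_order all_algebra.
From mathcomp Require Export all_classical all_reals all_analysis.

Set Implicit Arguments.
Unset Strict Implicit.
Unset Printing Implicit Defensive.

Import Order.TTheory GRing.Theory Num.Theory.
Import numFieldNormedType.Exports.

Local Open Scope classical_set_scope.
Local Open Scope ring_scope.

Definition measure_preserving (d : measure_display) (X : measurableType d)
    (R : realType) (mu : probability X R) (T : X -> X) : Prop :=
  measurable_fun [set: X] T /\
  forall E : set X, measurable E -> mu (T @^-1` E) = mu E.

(* [partition] also asks for nonempty blocks; preimages T^-i Q of partitions
   are only used through [join_preimages], where empty blocks are harmless. *)
Definition countable_measurable_partition (d : measure_display)
    (X : measurableType d) (Q : set (set X)) : Prop :=
  [/\ countable Q, Q `<=` measurable & partition Q id [set: X]].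

Definition preimage_partition (X : Type) (T : X -> X) (i : nat)
    (Q : set (set X)) : set (set X) :=
  [set iter i T @^-1` A | A in Q].

(* The common refinement of Q, T^-1 Q, ..., T^-(n-1) Q: its blocks are the
   intersections of one block of each. For n = 0 it is the partition {X}. *)
Definition join_preimages (X : Type) (T : X -> X) (Q : set (set X))
    (n : nat) : set (set X) :=
  [set \bigcap_(i in `I_n) B i | B in
    [set B : nat -> set X |
      forall i : nat, (i < n)%N -> preimage_partition T i Q (B i)]].

Definition invariant_sets (d : measure_display) (X : measurableType d)
    (T : X -> X) : set (set X) :=
  [set E | measurable E /\ T @^-1` E = E].

Definition partition_sigma_algebra (X : Type) (T : X -> X) (Q : set (set X)) :
    set (set X) :=
  <<s \bigcup_(n in [set n | (0 < n)%N]) join_preimages T Q n >>.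

(* For k = 0 this is 0. *)
Definition time_average (X : Type) (R : realType) (T : X -> X) (f : X -> R)
    (k : nat) (x : X) : R :=
  k%:R^-1 * \sum_(j < k) f (iter j T x).

(* h is a version of the conditional expectation E[g | F]. F is meant to be a
   sub-sigma-algebra of the measurable sets, given as a family of sets. *)
Definition is_cond_exp (d : measure_display) (X : measurableType d)
    (R : realType) (mu : probability X R) (F : set (set X))
    (g h : X -> R) : Prop :=
  [/\ forall B : set R, measurable B -> F (h @^-1` B),
      mu.-integrable [set: X] (EFin \o h) &
      forall A : set X, F A ->
        (\int[mu]_(x in A) (h x)%:E = \int[mu]_(x in A) (g x)%:E)%E].

(* Main.v *)
Require Import Defs.
From mathcomp Require Import ring lra measurable_realfun.
Set Implicit Arguments.
Unset Strict Implicit.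
Unset Printing Implicit Defensive.
Import Order.TTheory GRing.Theory Num.Theory.
Import numFieldNormedType.Exports.
Local Open Scope classical_set_scope.
Local Open Scope ring_scope.

(** Conditioning on [join_preimages T Q n] is averaging over its blocks: at a
point [x] whose blocks all have positive measure, [h n k x] is the mean of the
time average [A_k f] over the block [B_n x] containing [x]
([cond_exp_cell_mean]).  Let [F] be the almost sure limit of [A_k f].  For
[k >= N] the mean of [A_k f] over [B_n x] differs from that of [F] by at most
the mean of [M_N], the supremum over [k >= N] of [|A_k f - F|], and the theorem
splits into two statements.

First, the means of [M_N] are small uniformly in [n]: by the maximal inequality
for nested blocks ([cell_maximal]) the set where some mean of [M_N] exceeds [c]
has measure at most [c^-1] times the integral of [M_N], so it is enough that
this integral tends to [0] ([uniformly_small_means]).  It does by dominated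
convergence, and this is where [p > 1] enters: the supremum of the averages of
[|f|] is integrable for [f] in [L^p], by the maximal ergodic theorem summed over
dyadic levels ([integrable_max_average]).  The same maximal theorem gives the
pointwise convergence ([birkhoff_cvg]).

Second, the means of [F] over [B_n x] tend to [g x].  They are equal to the
means of [g], because [F] and [g] have the same integral over every set [B] of
the sigma-algebra generated by all the blocks.  Indeed [F - g] is invariant, so
its integral over [B] equals its integral against the averages of [\1_B], hence
against their limit.  As preimages under [T] stay in that sigma-algebra, the
limit is measurable both for it and for the invariant sets, and on such sets
[F], [f] and [g] have the same integrals ([invariant_integral0]).  Finally the
means of [g] converge to [g]: the functions recovered from their means are
stable under limits in [L^1], again by the maximal inequality for blocks, and
they include the indicators of the blocks ([resolved_integrable]). *)

(** * Null sets and Markov's inequality *)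

Lemma L1_measurable d (X : measurableType d) (R : realType)
    (mu : probability X R) (phi : X -> R) :
  mu.-integrable setT (EFin \o phi) -> measurable_fun setT phi.
Proof. by case/integrableP => /measurable_EFinP. Qed.

Section small_sets.
Context d (X : measurableType d) (R : realType) (mu : probability X R).

Lemma negligible_small (S : set X) :
  (forall e : R, 0 < e -> exists B : set X,
    [/\ measurable B, S `<=` B & (mu B <= e%:E)%E]) ->
  mu.-negligible S.
Proof.
move=> H; pose e n : R := n.+1%:R^-1.
have He n : 0 < e n by rewrite invr_gt0 ltr0n.
have [B HB] := choice (fun n => H (e n) (He n)).
exists (\bigcap_n B n); split.
- by apply: bigcapT_measurable => n; have [] := HB n.
- apply/eqP; rewrite -measure_le0; apply/lee_addgt0Pr => r r0.
  have [n _ Hn] : \forall n \near \oo, (e n < r).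
    by apply: (@near_infty_natSinv_lt _ (PosNum r0)).
  have [mB _ Bn] := HB n.
  apply: (@le_trans _ _ (mu (B n))).
    apply: le_measure; rewrite ?inE//; last exact: bigcap_inf.
    by apply: bigcapT_measurable => k; have [] := HB k.
  by rewrite add0e (le_trans Bn)// lee_fin ltW// Hn/=.
- by move=> x Sx n _; have [_ + _] := HB n; exact.
Qed.

Lemma markov_ge0 (phi : X -> \bar R) (c : R) : measurable_fun setT phi ->
  (forall x, 0 <= phi x)%E -> 0 < c ->
  (c%:E * mu [set x | (c%:E <= phi x)%E] <= \int[mu]_x phi x)%E.
Proof.
move=> mphi phi0 c0.
have /= := @le_integral_abse _ _ _ mu _ measurableT phi c mphi c0.
rewrite setTI.
under [in X in (_ <= X -> _)%E]eq_integral do rewrite gee0_abs//.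
by under [in X in (_ * mu X <= _ -> _)%E]eq_set do rewrite gee0_abs//.
Qed.

End small_sets.

(** * Means over the cells of a refining sequence of partitions *)

Section cells.
Context d (X : measurableType d) (R : realType) (mu : probability X R).

(** A countable partition is presented by a labelling [X -> nat]: countable
unions of cells are then unions over labels, and the sets of the generated
sigma-algebra are the saturated ones. *)
Definition cell (a : nat -> X -> nat) (n : nat) (x : X) : set X :=
  a n @^-1` [set a n x].

Definition refining (a : nat -> X -> nat) :=
  forall m n x y, (m <= n)%N -> a n x = a n y -> a m x = a m y.

Definition cell_mean (a : nat -> X -> nat) (n : nat) (phi : X -> R) (x : X) :
    R :=
  (\int[mu]_(y in cell a n x) phi y) / fine (mu (cell a n x)).

Lemma saturatedE (b : X -> nat) (E : set X) :
  (forall x y, b x = b y -> E x -> E y) ->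
  E = \bigcup_j
    (if `[< exists2 x, E x & b x = j >] then b @^-1` [set j] else set0).
Proof.
move=> sE; apply/seteqP; split => [x Ex|x [j _]].
  by exists (b x) => //; case: asboolP => // -[]; exists x.
by case: asboolP => // -[y Ey <-] /= xy; apply: sE Ey.
Qed.

Lemma saturated_measurable (b : X -> nat) (E : set X) :
  (forall j, measurable (b @^-1` [set j])) ->
  (forall x y, b x = b y -> E x -> E y) -> measurable E.
Proof.
move=> mb sE; rewrite (saturatedE sE).
by apply: bigcupT_measurable => j; case: asboolP.
Qed.

Lemma bigcup_density (phi : X -> \bar R) (c : R) (D : nat -> set X) :
  measurable_fun setT phi -> (forall x, 0 <= phi x)%E ->
  (forall i, measurable (D i)) -> trivIset setT D ->
  (forall i, c%:E * mu (D i) <= \int[mu]_(x in D i) phi x)%E -> 0 <= c ->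
  (c%:E * mu (\bigcup_i D i) <= \int[mu]_(x in \bigcup_i D i) phi x)%E.
Proof.
move=> mphi phi0 mD tD cD c0.
rewrite ge0_integral_bigcup//; last exact: measurable_funTS.
rewrite measure_semi_bigcup//; last exact: bigcupT_measurable.
rewrite -nneseriesZl; last by move=> *; exact: measure_ge0.
by apply: lee_nneseries => [i _ _|i _]; [rewrite mule_ge0|exact: cD].
Qed.

(** A lower bound for the density of [phi] on single cells passes to unions of
cells by countable additivity. *)
Lemma saturated_density (b : X -> nat) (E : set X) (phi : X -> \bar R) (c : R) :
  (forall j, measurable (b @^-1` [set j])) ->
  measurable_fun setT phi -> (forall x, 0 <= phi x)%E -> 0 <= c ->
  (forall x y, b x = b y -> E x -> E y) ->
  (forall x, E x -> c%:E * mu (b @^-1` [set b x]) <=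
                    \int[mu]_(y in b @^-1` [set b x]) phi y)%E ->
  (c%:E * mu E <= \int[mu]_(x in E) phi x)%E.
Proof.
move=> mb mphi phi0 c0 sE cE; rewrite (saturatedE sE).
apply: bigcup_density => //.
- by move=> j; case: asboolP.
- move=> i j _ _ [x []]; case: asboolP => // _ + ; case: asboolP => // _.
  by move=> /= <- <-.
- move=> j; case: asboolP => [[x Ex <-]|_]; first exact: cE.
  by rewrite measure0 mule0 integral_set0.
Qed.

Context (a : nat -> X -> nat).
Hypothesis ma : forall n j, measurable (a n @^-1` [set j]).
Hypothesis ra : refining a.

Lemma measurable_cell n x : measurable (cell a n x).
Proof. exact: ma. Qed.

Lemma cell_eq n x y : a n x = a n y -> cell a n x = cell a n y.
Proof. by rewrite /cell => ->. Qed.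

(** Doob's maximal inequality.  Sorting the points by the first [n] at which
their cell is heavy cuts [E] into disjoint pieces; since a cell determines the
coarser cells around it, each piece is a union of cells of level [n]. *)
Lemma cell_maximal (phi : X -> \bar R) (c : R) :
  measurable_fun setT phi -> (forall x, 0 <= phi x)%E -> 0 <= c ->
  let E := [set x | exists n, (c%:E * mu (cell a n x) <
                               \int[mu]_(y in cell a n x) phi y)%E] in
  measurable E /\ (c%:E * mu E <= \int[mu]_x phi x)%E.
Proof.
move=> mphi phi0 c0 E.
pose W n := [set x | (c%:E * mu (cell a n x) <
                               \int[mu]_(y in cell a n x) phi y)%E].
have sW m n x y : (m <= n)%N -> a n x = a n y -> W m x -> W m y.
  by move=> mn xy; rewrite /W/= (cell_eq (ra mn xy)).
have sD n x y : a n x = a n y -> seqDU W n x -> seqDU W n y.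
  move=> xy [Wx nWx]; split; first exact: sW (leqnn n) xy Wx.
  move=> Wy; apply: nWx; move: Wy; rewrite -!bigcup_mkord => -[m /= mn Wy].
  by exists m => //; apply: (@sW m n y x) => //; exact: ltnW.
have mD n : measurable (seqDU W n) by exact: saturated_measurable (@sD n).
have EE : E = \bigcup_n seqDU W n.
  rewrite -seqDU_bigcup_eq; apply/seteqP; split => x [n]; first by exists n.
  by move=> _ Wx; exists n.
have mE : measurable E by rewrite EE; exact: bigcupT_measurable.
split=> //; apply: (@le_trans _ _ (\int[mu]_(x in E) phi x)%E); last first.
  exact: ge0_subset_integral.
rewrite EE; apply: bigcup_density => // n.
apply: (saturated_density (ma n)) => //; first exact: sD.
by move=> x [Wx _]; exact: ltW.
Qed.

(** Each level has countably many cells, so the null ones cover a null set. *)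
Lemma cells_pos_ae : {ae mu, forall x, forall n, 0 < fine (mu (cell a n x))}.
Proof.
apply/ae_foralln => n.
apply: (@negligibleS _ _ _ _ (\bigcup_j
  (if mu (a n @^-1` [set j]) == 0%E then a n @^-1` [set j] else set0))).
  move=> x /= /negP; rewrite -leNgt => x0; exists (a n x) => //.
  case: ifPn => //; rewrite -/(cell a n x) => /negP; apply.
  rewrite -measure_le0 -(fineK (fin_num_measure mu _ (measurable_cell n x))).
  by rewrite lee_fin.
apply: negligible_bigcup => j; case: ifPn => [/eqP mu0|_].
  exact/negligibleP.
exact: negligible_set0.
Qed.

End cells.

Section martingale_convergence.
Context d (X : measurableType d) (R : realType) (mu : probability X R).
Context (a : nat -> X -> nat).
Hypothesis ma : forall n j, measurable (a n @^-1` [set j]).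
Hypothesis ra : refining a.

Let L1 (phi : X -> R) := mu.-integrable setT (EFin \o phi).

Lemma integrable_on (D : set X) (phi : X -> R) : measurable D -> L1 phi ->
  mu.-integrable D (EFin \o phi).
Proof. by move=> mD; exact: integrableS. Qed.

Lemma cell_meanD n (phi psi : X -> R) x : L1 phi -> L1 psi ->
  cell_mean mu a n (fun y => phi y + psi y) x =
  cell_mean mu a n phi x + cell_mean mu a n psi x.
Proof.
move=> iphi ipsi; rewrite /cell_mean -mulrDl RintegralD//.
- exact: measurable_cell.
- by apply: integrable_on => //; exact: measurable_cell.
- by apply: integrable_on => //; exact: measurable_cell.
Qed.

Lemma cell_meanZ n (c : R) (phi : X -> R) x : L1 phi ->
  cell_mean mu a n (fun y => c * phi y) x = c * cell_mean mu a n phi x.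
Proof.
move=> iphi; rewrite /cell_mean RintegralZl ?mulrA//.
- exact: measurable_cell.
- by apply: integrable_on => //; exact: measurable_cell.
Qed.

Lemma cell_meanB n (phi psi : X -> R) x : L1 phi -> L1 psi ->
  cell_mean mu a n (fun y => phi y - psi y) x =
  cell_mean mu a n phi x - cell_mean mu a n psi x.
Proof.
move=> iphi ipsi; rewrite /cell_mean -mulrBl RintegralB//.
- exact: measurable_cell.
- by apply: integrable_on => //; exact: measurable_cell.
- by apply: integrable_on => //; exact: measurable_cell.
Qed.

Lemma cell_mean_norm n (phi : X -> R) x : L1 phi ->
  `|cell_mean mu a n phi x| <= cell_mean mu a n (fun y => `|phi y|) x.
Proof.
move=> iphi; have m0 : 0 <= fine (mu (cell a n x)) by rewrite fine_ge0.
rewrite /cell_mean normrM normfV (ger0_norm m0).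
apply: ler_wpM2r; first by rewrite invr_ge0.
apply: le_normr_Rintegral; first exact: measurable_cell.
by apply: integrable_on => //; exact: measurable_cell.
Qed.

(** On a null cell [cell_mean] is [0], a division by [0], and does not exceed
[c]. *)
Lemma cell_mean_gt n (phi : X -> R) (c : R) x : L1 phi -> 0 <= c ->
  c < cell_mean mu a n phi x ->
  (c%:E * mu (cell a n x) < \int[mu]_(y in cell a n x) (phi y)%:E)%E.
Proof.
move=> iphi c0; have mc := measurable_cell ma n x.
have ic := integrable_on mc iphi.
rewrite /cell_mean -(fineK (fin_num_measure mu _ mc)).
rewrite -[X in _ -> (_ < X)%E](fineK (integrable_fin_num mc ic)) -EFinM.
rewrite lte_fin/=.
rewrite -/(Rintegral mu (cell a n x) phi).
have := fine_ge0 (measure_ge0 mu (cell a n x)).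
rewrite le_eqVlt => /predU1P[<-|m0]; last by rewrite ltr_pdivlMr.
by rewrite invr0 mulr0 ltNge c0.
Qed.

Definition resolved (phi : X -> R) :=
  {ae mu, forall x, cell_mean mu a n phi x @[n --> \oo] --> phi x}.

Lemma resolvedD (phi psi : X -> R) : L1 phi -> L1 psi ->
  resolved phi -> resolved psi -> resolved (fun y => phi y + psi y).
Proof.
move=> iphi ipsi; apply: filterS2 => x cphi cpsi.
have -> : (cell_mean mu a)^~ (fun y => phi y + psi y) ^~ x =
    (fun n => cell_mean mu a n phi x + cell_mean mu a n psi x).
  by apply/funext => n; exact: cell_meanD.
exact: cvgD.
Qed.

Lemma resolvedZ (c : R) (phi : X -> R) : L1 phi ->
  resolved phi -> resolved (fun y => c * phi y).
Proof.
move=> iphi; apply: filterS => x cphi.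
have -> : (cell_mean mu a)^~ (fun y => c * phi y) ^~ x =
    (fun n => c * cell_mean mu a n phi x).
  by apply/funext => n; exact: cell_meanZ.
exact: cvgZr.
Qed.

Lemma L1_norm_diff (phi psi : X -> R) : L1 phi -> L1 psi ->
  L1 (fun y => `|phi y - psi y|).
Proof.
by move=> iphi ipsi; apply: (@integrable_norm _ _ _ mu setT (phi \- psi)) => //;
  apply: (@integrableB _ _ _ mu setT measurableT _ _ iphi ipsi).
Qed.

(** The maximal inequality makes the class of resolved functions closed in
[L^1]: if [psi] is close to [phi] in [L^1], then outside a small set both
[|phi - psi|] and all its means over cells are small. *)
Lemma resolved_closed (phi : X -> R) : L1 phi ->
  (forall e : R, 0 < e -> exists psi : X -> R,
    [/\ L1 psi, resolved psi & (\int[mu]_x `|phi x - psi x|%:E <= e%:E)%E]) ->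
  resolved phi.
Proof.
move=> iphi H.
suff S (k : nat) : {ae mu, forall x, \forall n \near \oo,
    `|phi x - cell_mean mu a n phi x| <= k.+1%:R^-1}.
  move/ae_foralln : S; apply: filterS => x Hx.
  apply/cvgrPdist_le => e e0.
  have [k _ Hk] : \forall k \near \oo, (k.+1%:R^-1 < e).
    by apply: (@near_infty_natSinv_lt _ (PosNum e0)).
  near=> n; apply: (@le_trans _ _ k.+1%:R^-1); last exact/ltW/Hk/leqnn.
  by near: n; exact: Hx.
set eps : R := _^-1.
have eps0 : 0 < eps by rewrite invr_gt0.
apply: negligible_small => eta eta0.
have [|psi [ipsi rpsi dpsi]] := H (eta * (eps / 6)).
  by rewrite mulr_gt0// divr_gt0.
have [N [mN N0 HN]] := rpsi.
pose D x := `|phi x - psi x|.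
have iD : L1 D by exact: L1_norm_diff.
have mD : measurable_fun setT (EFin \o D) by case/integrableP : iD.
have D0 x : (0 <= (EFin \o D) x)%E by rewrite lee_fin normr_ge0.
have c0 : 0 < eps / 3 by rewrite divr_gt0.
have [mE Ele] := cell_maximal mu ma ra mD D0 (ltW c0).
set E := [set x | _] in mE Ele.
have Fle := markov_ge0 mu mD D0 c0.
set F := [set x | _] in Fle.
have mF : measurable F.
  by rewrite -[F]setTI; apply: emeasurable_fun_c_infty.
exists (N `|` (E `|` F)); split.
- by apply: measurableU => //; exact: measurableU.
- move=> x /= nx; apply: contrapT => /not_orP[Nx /not_orP[Ex Fx]]; apply: nx.
  have /cvgrPdist_lt cx : cell_mean mu a n psi x @[n --> \oo] --> psi x.
    by apply: contrapT => h; apply: Nx; exact: HN.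
  near=> n.
  have h1 : `|psi x - cell_mean mu a n psi x| < eps / 3.
    by near: n; exact: cx.
  have h2 : D x < eps / 3.
    by rewrite ltNge; apply/negP => h; apply: Fx; rewrite /F/= lee_fin.
  have h3 : cell_mean mu a n D x <= eps / 3.
    rewrite leNgt; apply/negP => h; apply: Ex; exists n.
    by apply: cell_mean_gt => //; exact: ltW.
  have h4 : `|cell_mean mu a n psi x - cell_mean mu a n phi x| <= eps / 3.
    by rewrite distrC -cell_meanB// (le_trans (cell_mean_norm n x _))//;
      apply: (@integrableB _ _ _ mu setT measurableT _ _ iphi ipsi).
  rewrite (_ : phi x - cell_mean mu a n phi x = (phi x - psi x) +
    (psi x - cell_mean mu a n psi x) +
    (cell_mean mu a n psi x - cell_mean mu a n phi x)); last by ring.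
  rewrite (le_trans (ler_normD _ _))//.
  have := ler_normD (phi x - psi x) (psi x - cell_mean mu a n psi x).
  move: h1 h2 h4; rewrite /D; lra.
- have bound (A : set X) : measurable A ->
      ((eps / 3)%:E * mu A <= \int[mu]_x (EFin \o D) x)%E ->
      (mu A <= (eta / 2)%:E)%E.
    move=> mA hA; rewrite -(@lee_pmul2l _ (eps / 3)%:E)// (le_trans hA)//.
    rewrite (le_trans dpsi)// -EFinM lee_fin.
    by rewrite le_eqVlt; apply/orP; left; apply/eqP; field.
  have -> : eta%:E = (0 + ((eta / 2)%:E + (eta / 2)%:E))%E.
    by rewrite add0e -EFinD -splitr.
  apply: (le_trans (measureU2 _ mN (measurableU _ _ mE mF))).
  apply: leeD; first by rewrite le_eqVlt; apply/orP; left; apply/eqP; exact: N0.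
  apply: (le_trans (measureU2 _ mE mF)).
  by apply: leeD; exact: bound.
Unshelve. all: by end_near. Qed.


End martingale_convergence.

(** * Recovering a function from its means over cells *)

Section count.
Context (R : realType).

(** The thresholds [1, 2, ..., N] lying below [y] count the integer part of
[y], up to an error of [1] which absorbs what happens at [y] itself. *)
Lemma count_levels (z : nat -> bool) (y : R) (N : nat) : 0 <= y ->
  (forall i, i.+1%:R < y -> z i) -> (forall i, z i -> i.+1%:R <= y) ->
  \sum_(i < N) (z i)%:R <= y /\ (y <= N%:R -> y - 1 <= \sum_(i < N) (z i)%:R).
Proof.
move=> y0 z1 z2.
suff [//] : [/\ \sum_(i < N) (z i)%:R <= y,
  N%:R < y -> \sum_(i < N) (z i)%:R = N%:R :> R &
  (y <= N%:R -> y - 1 <= \sum_(i < N) (z i)%:R)].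
elim: N => [|N [IH1 IH2 IH3]].
  by rewrite !big_ord0; split => // y0'; rewrite lerBlDr add0r (le_trans y0').
rewrite big_ord_recr/=; case: (boolP (z N)) => zN /=.
  have yN := z2 _ zN.
  have /IH2 -> : N%:R < y by rewrite (lt_le_trans _ yN)// ltr_nat.
  rewrite -natr1 in yN *; split => //.
  lra.
rewrite addr0.
have yN : y <= N.+1%:R by rewrite leNgt; apply: contra zN => /z1.
split => //; first by rewrite ltNge yN.
move=> _; have [/IH3//|/IH2 ->] := leP y N%:R.
by move: yN; rewrite -natr1; lra.
Qed.

(** Rounding [t] towards zero to a multiple of [1 / m.+1] of modulus at most
[m.+1]. *)
Definition round_down (m : nat) (t : R) : R := m.+1%:R^-1 *
  \sum_(i < m.+1 * m.+1)
    ((i.+1%:R <= m.+1%:R * t)%R%:R + (-1) * (i.+1%:R <= m.+1%:R * - t)%R%:R).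

Lemma round_downP (m : nat) (t : R) : `|round_down m t| <= `|t| /\
  (`|t| <= m.+1%:R -> `|t - round_down m t| <= m.+1%:R^-1).
Proof.
wlog t0 : t / 0 <= t.
  move=> H; have [|t0] := leP 0 t; first exact: H.
  have -> : round_down m t = - round_down m (- t).
    rewrite /round_down opprK -mulrN -sumrN; congr (_ * _).
    by apply: eq_bigr => i _; ring.
  rewrite normrN opprK -(normrN t) -(normrN (t + _)) opprD.
  by apply: H; rewrite oppr_ge0 ltW.
have m0 : 0 < m.+1%:R :> R by rewrite ltr0n.
have mt0 : 0 <= m.+1%:R * t by rewrite mulr_ge0// ltW.
have [H1 H2] := @count_levels (fun i => i.+1%:R <= m.+1%:R * t) (m.+1%:R * t)
  (m.+1 * m.+1)%N mt0 (fun i => @ltW _ _ _ _) (fun i h => h).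
have -> : round_down m t =
    m.+1%:R^-1 * \sum_(i < m.+1 * m.+1) (i.+1%:R <= m.+1%:R * t)%R%:R.
  congr (_ * _); apply: eq_bigr => i _.
  suff -> : (i.+1%:R <= m.+1%:R * - t) = false by rewrite mulr0 addr0.
  by apply/negbTE; rewrite -ltNge mulrN (le_lt_trans _ (ltr0Sn _ _))// oppr_le0.
move: H1 H2; set S := \sum_(_ < _) _ => H1 H2.
have S0 : 0 <= S by rewrite sumr_ge0.
have H1' : m.+1%:R^-1 * S <= t by rewrite ler_pdivrMl.
split; first by rewrite !ger0_norm// mulr_ge0// invr_ge0 ltW.
rewrite !ger0_norm ?subr_ge0// => tm.
have /H2 : m.+1%:R * t <= (m.+1 * m.+1)%:R by rewrite natrM ler_pM2l.
by rewrite lerBlDr -ler_pdivlMl// mulrDr mulr1 lerBlDr addrC.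
Qed.

End count.

Section resolved_measurable.
Context d (X : measurableType d) (R : realType) (mu : probability X R).
Context (a : nat -> X -> nat).
Hypothesis ma : forall n j, measurable (a n @^-1` [set j]).
Hypothesis ra : refining a.

Let L1 (phi : X -> R) := mu.-integrable setT (EFin \o phi).

(** Dominated convergence provides the approximation in [L^1] which
[resolved_closed] asks for. *)
Lemma resolved_dominated (phi_ : nat -> X -> R) (phi psi : X -> R) :
  L1 psi -> (forall i, L1 (phi_ i)) -> (forall i, resolved mu a (phi_ i)) ->
  (forall x, phi_ i x @[i --> \oo] --> phi x) ->
  (forall i x, `|phi_ i x| <= psi x) -> L1 phi /\ resolved mu a phi.
Proof.
move=> ipsi iphi_ rphi_ cphi_ dphi_.
have mphi_ i : measurable_fun setT (phi_ i).
  by apply/measurable_EFinP; case/integrableP : (iphi_ i).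
have mphi : measurable_fun setT phi.
  by apply: (measurable_fun_cvg mphi_) => x _; exact: cphi_.
have [iphi dcv _] : [/\ L1 phi,
    (\int[mu]_x `|(phi_ i x)%:E - (phi x)%:E|)%E @[i --> \oo] --> 0%E &
    (\int[mu]_x (phi_ i x)%:E)%E @[i --> \oo] --> (\int[mu]_x (phi x)%:E)%E].
  apply: (@dominated_convergence _ _ _ mu setT measurableT
    (fun i => EFin \o phi_ i) (EFin \o phi) (EFin \o psi)) => //.
  - by move=> i; exact/measurable_EFinP.
  - exact/measurable_EFinP.
  - by apply: aeW => x _; apply: cvg_EFin => //; [exact: nearW|exact: cphi_].
  - by apply: aeW => x i _; rewrite lee_fin.
split => //; apply: resolved_closed => // e e0.
have /fine_cvgP[_ /cvgrPdist_le/(_ _ e0)[i _ Hi]] := dcv.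
exists (phi_ i); split; [exact: iphi_|exact: rphi_|].
under eq_integral do rewrite distrC.
have iD := L1_norm_diff (iphi_ i) iphi.
rewrite -[X in (X <= _)%E](fineK (integrable_fin_num measurableT iD)) lee_fin.
by apply: le_trans (Hi i (leqnn _)); rewrite /= sub0r normrN ler_norm.
Qed.

Definition cell_algebra := [set A | exists n J, A = a n @^-1` J].

Lemma cell_algebraI : setI_closed cell_algebra.
Proof.
have H m n J K : (m <= n)%N -> cell_algebra (a m @^-1` J `&` a n @^-1` K).
  move=> mn; exists n, (a n @` (a m @^-1` J `&` a n @^-1` K)).
  apply/seteqP; split => [x|x [y [Jy Ky] yx]]; first by exists x.
  by split => /=; [rewrite -(ra mn yx)|rewrite -yx].
move=> A B [m [J ->]] [n [K ->]].
by case: (leqP m n) => [|/ltnW] mn; [|rewrite setIC]; exact: H.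
Qed.

Lemma resolved_cst (c : R) : resolved mu a (cst c).
Proof.
apply: filterS (cells_pos_ae mu ma) => x posx.
apply: cvg_near_cst; apply: nearW => n.
rewrite /cell_mean Rintegral_cst; last exact: measurable_cell.
by rewrite /= mulfK// gt_eqF// posx.
Qed.

(** From level [m] on, every cell is inside the set or disjoint from it. *)
Lemma resolved_cell_algebra A : cell_algebra A -> resolved mu a (\1_A : X -> R).
Proof.
move=> [m [J ->]]; apply: filterS (cells_pos_ae mu ma) => x posx.
apply: cvg_near_cst; exists m => // n /= mn.
rewrite /cell_mean (@eq_Rintegral _ _ _ _ _ (cst (\1_(a m @^-1` J) x))).
  rewrite Rintegral_cst; last exact: measurable_cell.
  by rewrite mulfK// gt_eqF// posx.
move=> y; rewrite inE => yx; rewrite /= !indicE; congr ((nat_of_bool _)%:R).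
by apply/idP/idP; rewrite !in_setE /= (ra mn yx).
Qed.

Lemma cell_algebra_measurable A : cell_algebra A -> measurable A.
Proof.
move=> [n [J ->]]; apply: (saturated_measurable (ma n)) => x y /= -> //.
Qed.

Lemma L1_indic (A : set X) : measurable A -> L1 \1_A.
Proof. by move=> mA; apply: integrable_indic. Qed.

(** The cells generate the sigma-algebra, so the resolved sets fill it by the
pi-lambda theorem. *)
Lemma resolved_indic A : <<s cell_algebra >> A ->
  measurable A /\ resolved mu a (\1_A : X -> R).
Proof.
apply: (@lambda_system_subset _ _ cell_algebraI setT
  [set A | measurable A /\ resolved mu a (\1_A : X -> R)]) => //; last first.
  move=> B cB; split; first exact: cell_algebra_measurable.
  exact: resolved_cell_algebra.
split => //.
- by split => //; rewrite indicT; exact: resolved_cst.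
- move=> B C CB [mB rB] [mC rC]; split; first exact: measurableD.
  rewrite (_ : \1_(B `\` C) = (fun x => \1_B x + (-1) * \1_C x)).
    apply: resolvedD => //; [exact: L1_indic| |].
      2: exact: resolvedZ (L1_indic _) _.
    apply: (@integrableZl _ _ _ mu setT measurableT (-1) _ (L1_indic mC)).
  apply/funext => x; rewrite !indicE in_setD mulN1r.
  have [xC|xC] := boolP (x \in C); last by rewrite subr0 andbT.
  by rewrite andbF (mem_set (CB _ (set_mem xC))) subrr.
- move=> F ndF HF; split.
    by apply: bigcupT_measurable => i; have [] := HF i.
  apply: (@resolved_dominated (fun i => \1_(F i)) _ (cst 1) _ _ _ _ _).2.
  + exact: finite_measure_integrable_cst.
  + by move=> i; apply: L1_indic; have [] := HF i.
  + by move=> i; have [] := HF i.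
  + move=> x; apply: cvg_near_cst.
    have [[n _ Fnx]|nx] := pselect ((\bigcup_i F i) x).
      exists n => // k /= nk; rewrite !indicE !mem_set//.
        by exists n.
      by have /subsetPset := ndF _ _ nk; exact.
    apply: nearW => n; rewrite !indicE !memNset// => Fnx.
    by apply: nx; exists n.
  + by move=> i x; rewrite indicE; case: (_ \in _); rewrite /= ?normr0 ?normr1.
Qed.

Lemma resolved_sum (n : nat) (phi_ : nat -> X -> R) :
  (forall i, L1 (phi_ i) /\ resolved mu a (phi_ i)) ->
  L1 (fun x => \sum_(i < n) phi_ i x) /\
  resolved mu a (fun x => \sum_(i < n) phi_ i x).
Proof.
move=> H; elim: n => [|n [IH1 IH2]].
  under eq_fun do rewrite big_ord0.
  by split; [exact: integrable0|exact: resolved_cst].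
under eq_fun do rewrite big_ord_recr/=.
have [H1 H2] := H n; split; last exact: resolvedD.
exact: (@integrableD _ _ _ mu setT measurableT _ _ IH1 H1).
Qed.

(** Levy's upward theorem.  Rounding [phi] towards zero gives combinations of
indicators of its level sets, which are resolved, and these are dominated by
[|phi|]. *)
Lemma resolved_integrable (phi : X -> R) : L1 phi ->
  (forall B, measurable B -> <<s cell_algebra >> (phi @^-1` B)) ->
  resolved mu a phi.
Proof.
move=> iphi gphi.
pose U (m i : nat) := [set x | i.+1%:R <= m.+1%:R * phi x].
pose V (m i : nat) := [set x | i.+1%:R <= m.+1%:R * - phi x].
pose phi_ (m : nat) x : R := m.+1%:R^-1 *
  (\sum_(i < m.+1 * m.+1) (\1_(U m i) x + (-1) * \1_(V m i) x)).
have gU m i : <<s cell_algebra >> (U m i).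
  rewrite (_ : U m i = phi @^-1` `[m.+1%:R^-1 * i.+1%:R, +oo[).
    exact: gphi.
  by apply/seteqP; split => x /=; rewrite in_itv/= andbT ler_pdivrMl.
have gV m i : <<s cell_algebra >> (V m i).
  rewrite (_ : V m i = phi @^-1` `]-oo, - (m.+1%:R^-1 * i.+1%:R)]).
    exact: gphi.
  by apply/seteqP; split => x /=; rewrite in_itv/= lerNr ler_pdivrMl.
have H m : L1 (phi_ m) /\ resolved mu a (phi_ m).
  have K i : L1 (fun x => \1_(U m i) x + (-1) * \1_(V m i) x) /\
             resolved mu a (fun x => \1_(U m i) x + (-1) * \1_(V m i) x).
    have [mU rU] := resolved_indic (gU m i).
    have [mV rV] := resolved_indic (gV m i).
    have iV : L1 (fun x => (-1) * \1_(V m i) x).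
      exact: (@integrableZl _ _ _ mu setT measurableT (-1) _ (L1_indic mV)).
    split.
      exact: (@integrableD _ _ _ mu setT measurableT _ _ (L1_indic mU) iV).
    apply: resolvedD => //; first exact: L1_indic.
    by apply: resolvedZ => //; exact: L1_indic.
  have [S1 S2] := @resolved_sum (m.+1 * m.+1)%N
    (fun i x => \1_(U m i) x + (-1) * \1_(V m i) x) K.
  split; last exact: resolvedZ.
  exact: (@integrableZl _ _ _ mu setT measurableT (m.+1%:R^-1) _ S1).
have phi_E m x : phi_ m x = round_down m (phi x).
  congr (_ * _); apply: eq_bigr => i _; rewrite !indicE.
  by congr ((nat_of_bool _)%:R + _ * (nat_of_bool _)%:R); apply/idP/idP;
    rewrite in_setE.
apply: (@resolved_dominated phi_ phi (fun x => `|phi x|) _ _ _ _ _).2 => //.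
- exact: integrable_norm.
- by move=> i; have [] := H i.
- by move=> i; have [] := H i.
- move=> x; apply/cvgrPdist_le => e e0; near=> m.
  rewrite phi_E; have [_ K] := round_downP m (phi x).
  apply: le_trans (K _) _.
    near: m; apply: filterS (nbhs_infty_ger `|phi x|) => k /le_trans; apply.
    by rewrite ler_nat.
  by near: m; apply: filterS (@near_infty_natSinv_lt _ (PosNum e0)) => k /ltW.
- by move=> i x; rewrite phi_E; have [] := round_downP i (phi x).
Unshelve. all: by end_near. Qed.

End resolved_measurable.

(** * The maximal ergodic theorem *)

Lemma measurable_superlevel d (X : measurableType d) (R : realType)
    (phi : X -> R) (c : R) :
  measurable_fun setT phi -> measurable [set x | c < phi x].
Proof.
move=> mphi; rewrite (_ : [set x | _] = setT `&` phi @^-1` `]c, +oo[).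
  exact: mphi.
by apply/seteqP; split => x /=; rewrite in_itv/= andbT; [|case].
Qed.

Section maximal_ergodic.
Context d (X : measurableType d) (R : realType) (mu : probability X R).
Context (T : X -> X).
Hypothesis mpT : measure_preserving mu T.

Let L1 (phi : X -> R) := mu.-integrable setT (EFin \o phi).

Definition orbit_sum (phi : X -> R) (k : nat) (x : X) : R :=
  \sum_(j < k) phi (iter j T x).

Lemma orbit_sumS (phi : X -> R) k x :
  orbit_sum phi k.+1 x = phi x + orbit_sum phi k (T x).
Proof.
rewrite /orbit_sum big_ord_recl/=; congr (_ + _).
by apply: eq_bigr => j _; rewrite -iterSr.
Qed.

Lemma orbit_sum_comp (phi : X -> R) k x :
  orbit_sum phi k (T x) = orbit_sum phi k.+1 x - phi x.
Proof. by rewrite orbit_sumS addrC addKr. Qed.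

Lemma time_averageE (phi : X -> R) k x :
  time_average T phi k x = k%:R^-1 * orbit_sum phi k x.
Proof. by []. Qed.

Let mT : measurable_fun setT T. Proof. by case: mpT. Qed.

Lemma measurable_iter j : measurable_fun setT (iter j T).
Proof.
by elim: j => [|j IH]; [exact: measurable_id|exact: measurableT_comp].
Qed.

Lemma measurable_orbit_sum (phi : X -> R) k : measurable_fun setT phi ->
  measurable_fun setT (orbit_sum phi k).
Proof.
move=> mphi; apply: measurable_sum => j.
exact: (measurableT_comp mphi (measurable_iter j)).
Qed.

Lemma measurable_time_average (phi : X -> R) k : measurable_fun setT phi ->
  measurable_fun setT (time_average T phi k).
Proof.
move=> mphi; apply: measurable_funM; first exact: measurable_cst.
exact: measurable_orbit_sum.
Qed.

Lemma integral_comp (phi : X -> R) : L1 phi ->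
  L1 (phi \o T) /\ (\int[mu]_x (phi (T x))%:E = \int[mu]_x (phi x)%:E)%E.
Proof.
move=> iphi; have /integrableP[mphi fphi] := iphi.
have pE (psi : X -> \bar R) :
    (\int[pushforward mu T]_x psi x = \int[mu]_x psi x)%E.
  apply: eq_measure_integral => A mA _; rewrite /pushforward.
  by case: mpT => _; exact.
have ic : L1 (phi \o T).
  apply/integrableP; split; first exact: (measurableT_comp mphi mT).
  rewrite -(pE) in fphi.
  rewrite ge0_integral_pushforward in fphi => //.
  exact: measurableT_comp.
by split => //; rewrite -[RHS]pE integral_pushforward.
Qed.

Lemma integral_iter (phi : X -> R) j : L1 phi ->
  L1 (phi \o iter j T) /\
  (\int[mu]_x (phi (iter j T x))%:E = \int[mu]_x (phi x)%:E)%E.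
Proof.
move=> iphi; elim: j => [|j [IH1 IH2]]; first by [].
have [H1 H2] := integral_comp IH1.
rewrite (_ : phi \o iter j.+1 T = (phi \o iter j T) \o T); last first.
  by apply/funext => x /=; rewrite -iterSr.
by split => //; rewrite -IH2 -H2; apply: eq_integral => x _; rewrite iterSr.
Qed.

Lemma integrable_orbit_sum (phi : X -> R) k : L1 phi -> L1 (orbit_sum phi k).
Proof.
move=> iphi; rewrite /L1 /orbit_sum.
rewrite (_ : EFin \o _ = fun x => (\sum_(j < k) (phi (iter j T x))%:E)%E).
  by apply: integrable_sum => // j _; have [] := integral_iter j iphi.
by apply/funext => x /=; rewrite sumEFin.
Qed.

Lemma integrable_time_average (phi : X -> R) k :
  L1 phi -> L1 (time_average T phi k).
Proof.
move=> iphi; rewrite /time_average.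
exact: (@integrableZl _ _ _ mu setT measurableT (k%:R^-1) _
  (integrable_orbit_sum k iphi)).
Qed.

(** The maximum of [0] and of the first [n] orbit sums, in the recursive form
which compares its value at [x] with its value at [T x]. *)
Fixpoint max_sum (phi : X -> R) (n : nat) (x : X) : R :=
  if n is n'.+1 then Num.max 0 (phi x + max_sum phi n' (T x)) else 0.

Lemma max_sum_ge0 (phi : X -> R) n x : 0 <= max_sum phi n x.
Proof. by case: n => //= n; rewrite le_max lexx. Qed.

Lemma max_sum_le (phi : X -> R) n x : max_sum phi n x <= max_sum phi n.+1 x.
Proof.
elim: n x => [|n IH] x; first exact: max_sum_ge0.
rewrite [leLHS]/= [leRHS]/=.
by rewrite ge_max !le_max lexx/= lerD2l IH orbT.
Qed.

Lemma max_sum_nd (phi : X -> R) x :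
  {homo (max_sum phi)^~ x : m n / (m <= n)%N >-> m <= n}.
Proof.
by apply: homo_leq => // [? ? ?|n]; [exact: le_trans|exact: max_sum_le].
Qed.

Lemma orbit_sum_le_max (phi : X -> R) k x :
  orbit_sum phi k x <= max_sum phi k x.
Proof.
elim: k x => [|k IH] x; first by rewrite /orbit_sum big_ord0.
by rewrite orbit_sumS/= le_max lerD2l IH orbT.
Qed.

Lemma max_sum_gt0 (phi : X -> R) n x :
  0 < max_sum phi n x -> exists k, 0 < orbit_sum phi k x.
Proof.
suff [k ->] : exists k, max_sum phi n x = orbit_sum phi k x by exists k.
elim: n x => [|n IH] x; first by exists 0%N; rewrite /orbit_sum big_ord0.
have [k E] := IH (T x); rewrite /= E -orbit_sumS.
by case: leP => _; [exists k.+1|exists 0%N; rewrite /orbit_sum big_ord0].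
Qed.

Lemma integrable_max_sum (phi : X -> R) n : L1 phi -> L1 (max_sum phi n).
Proof.
move=> iphi; elim: n => [|n IH]; first exact: integrable0.
have [iT _] := integral_comp IH.
have iD : L1 (phi \+ (max_sum phi n \o T)).
  exact: (@integrableD _ _ _ mu setT measurableT _ _ iphi iT).
have mD := L1_measurable iD.
apply: le_integrable iD => //.
  by apply/measurable_EFinP; exact: measurable_maxr.
move=> x _ /=; rewrite lee_fin ger0_norm ?le_max ?lexx//.
by rewrite ge_max normr_ge0 ler_norm.
Qed.

Let up_step (phi : X -> R) n := [set x | 0 < max_sum phi n x].

(** Garsia's argument: where [m = max_sum phi n.+1] is positive, [phi] is at
least [m - m \o T]; elsewhere this difference is at most [0].  Its integral is
[0] by invariance of the measure. *)
Lemma max_sum_integral (phi : X -> R) n : L1 phi ->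
  (0 <= \int[mu]_(x in up_step phi n.+1) (phi x)%:E)%E.
Proof.
move=> iphi; have im := integrable_max_sum n.+1 iphi.
have [iT eT] := integral_comp im.
have mm := L1_measurable im.
have mE : measurable (up_step phi n.+1).
  exact: measurable_superlevel mm.
have -> : 0%E = (\int[mu]_x (max_sum phi n.+1 x - max_sum phi n.+1 (T x))%:E)%E.
  under eq_integral do rewrite EFinB.
  rewrite (integralB_EFin _ im iT)// eT subee//.
  exact: integrable_fin_num.
rewrite [leRHS]integral_mkcond; apply: le_integral => //.
- exact: (@integrableB _ _ _ mu setT measurableT _ _ im iT).
- by apply/(integrable_mkcond _ _).1 => //; exact: integrableS iphi.
- move=> x _; rewrite patchE.
  case: ifPn => [|/negP]; rewrite in_setE /up_step/=.
    move=> /[dup] x0; rewrite lt_max ltxx/= => x1.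
    rewrite lee_fin (max_idPr (ltW x1)) lerBlDr lerD2l.
    exact: max_sum_le.
  move=> /negP; rewrite -leNgt => x0; rewrite lee_fin subr_le0.
  exact: le_trans x0 (max_sum_ge0 phi n.+1 (T x)).
Qed.

Definition ups (phi : X -> R) := [set x | exists k, 0 < orbit_sum phi k x].

Lemma measurable_ups (phi : X -> R) :
  measurable_fun setT phi -> measurable (ups phi).
Proof.
move=> mphi; rewrite (_ : ups phi = \bigcup_k [set x | 0 < orbit_sum phi k x]).
  apply: bigcupT_measurable => k.
  exact/measurable_superlevel/measurable_orbit_sum.
by apply/seteqP; split => x [k]; [|move=> _] => x0; exists k.
Qed.

(** The sets of [max_sum_integral] increase to [ups phi]. *)
Lemma maximal_ergodic (phi : X -> R) :
  L1 phi -> (0 <= \int[mu]_(x in ups phi) (phi x)%:E)%E.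
Proof.
move=> iphi; have mphi := L1_measurable iphi.
have mE := measurable_ups mphi.
have mU n : measurable (up_step phi n).
  have mm := L1_measurable (integrable_max_sum n iphi).
  exact: measurable_superlevel mm.
have cv : (\int[mu]_x ((EFin \o phi) \_ (up_step phi n.+1)) x)%E
    @[n --> \oo] --> (\int[mu]_x ((EFin \o phi) \_ (ups phi)) x)%E.
  have [] // := @dominated_convergence _ _ _ mu setT measurableT
    (fun n => (EFin \o phi) \_ (up_step phi n.+1)) ((EFin \o phi) \_ (ups phi))
    (abse \o (EFin \o phi)).
  - move=> n; apply/(measurable_restrictT _ _).1 => //.
    by apply/measurable_EFinP; exact: measurable_funTS.
  - apply/(measurable_restrictT _ _).1 => //.
    by apply/measurable_EFinP; exact: measurable_funTS.
  - apply: aeW => x _; apply: cvg_near_cst.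
    have [[k k0]|nx] := pselect (ups phi x).
      exists k => // n /= kn; rewrite !patchE !mem_set//; first by exists k.
      rewrite /up_step/= (lt_le_trans k0)//.
      rewrite (le_trans (orbit_sum_le_max _ _ _))//.
      exact: (max_sum_nd phi x (leq_trans kn (leqnSn n))).
    apply: nearW => n; rewrite !patchE !memNset//.
    by move=> /max_sum_gt0.
  - exact: integrable_abse.
  - apply: aeW => x n _; rewrite patchE /=; case: ifP => // _.
    by rewrite abse0.
rewrite integral_mkcond -(cvg_lim _ cv)//; apply: lime_ge.
  by apply/cvg_ex; eexists; exact: cv.
by apply: nearW => n; rewrite -integral_mkcond; exact: max_sum_integral.
Qed.

(** The values of [phi] up to [c] contribute at most [c] to an average, so where
an average exceeds [2 * c] the maximal ergodic theorem applies to the remaining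
part of [phi] minus [c]. *)
Lemma maximal_inequality (phi : X -> R) (c : R) : L1 phi ->
  (forall x, 0 <= phi x) -> 0 < c ->
  let E := [set x | exists k, 2 * c < time_average T phi k x] in
  measurable E /\
  (c%:E * mu E <= \int[mu]_(x in [set x | (c < phi x)%R]) (phi x)%:E)%E.
Proof.
move=> iphi phi0 c0 E; have mphi := L1_measurable iphi.
have mE : measurable E.
  rewrite (_ : E = \bigcup_k [set x | 2 * c < time_average T phi k x]).
    apply: bigcupT_measurable => k.
    exact/measurable_superlevel/measurable_time_average.
  by apply/seteqP; split => x [k]; [|move=> _] => x0; exists k.
split => //.
set A := [set x | c < phi x].
have mA : measurable A by exact: measurable_superlevel.
pose psi := phi \_ A.
have ipsi : L1 psi.
  rewrite /L1 /psi -restrict_EFin.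
  by apply/(integrable_mkcond _ _).1 => //; exact: integrableS iphi.
have icst (D : set X) : measurable D -> mu.-integrable D (EFin \o cst c).
  by move=> mD; exact: finite_measure_integrable_cst.
pose chi := psi \- cst c.
have ichi : L1 chi.
  exact: (@integrableB _ _ _ mu setT measurableT _ _ ipsi (icst _ measurableT)).
have mU := measurable_ups (L1_measurable ichi).
have EU : E `<=` ups chi.
  move=> x [[|k]].
    by rewrite /time_average invr0 mul0r ltNge mulr_ge0// ltW.
  rewrite time_averageE ltr_pdivlMl// => kx; exists k.+1.
  have H : orbit_sum phi k.+1 x - k.+1%:R * c <= orbit_sum psi k.+1 x.
    rewrite lerBlDr /orbit_sum mulr_natl -[X in c *+ X](card_ord k.+1).
    rewrite -sumr_const -big_split/=.
    apply: ler_sum => j _; rewrite /psi patchE; case: ifPn => [_|].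
      by rewrite lerDl ltW.
    by rewrite notin_setE /A/= => /negP; rewrite -leNgt add0r.
  have -> : orbit_sum chi k.+1 x = orbit_sum psi k.+1 x - k.+1%:R * c.
    by rewrite /orbit_sum /chi sumrB sumr_const card_ord mulr_natl.
  by move: kx H; lra.
apply: (@le_trans _ _ (c%:E * mu (ups chi))%E).
  by rewrite lee_pmul2l// le_measure ?inE.
have := maximal_ergodic ichi.
have ipsiU := integrableS measurableT mU (@subsetT _ _) ipsi.
rewrite (integralB_EFin mU ipsiU (icst _ mU)).
rewrite (_ : (\int[mu]_(x in ups chi) (cst c x)%:E = c%:E * mu (ups chi))%E);
  last exact: (integral_cst mu mU c%:E).
rewrite sube_ge0; last by rewrite fin_numM// fin_num_measure.
move=> /le_trans; apply; rewrite [leRHS]integral_mkcond.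
rewrite restrict_EFin -/psi.
apply: ge0_subset_integral => //; first by case/integrableP : ipsi.
move=> x _; rewrite lee_fin /psi patchE; case: ifP => //.
Qed.

End maximal_ergodic.

(** * Integrability of the maximal function *)

Lemma Lfun_gt1 d (X : measurableType d) (R : realType) (mu : probability X R)
    (p : \bar R) (f : X -> R) : (1 < p)%E -> f \in Lfun mu p ->
  exists2 r : R, 1 < r & mu.-integrable setT (EFin \o f) /\
    mu.-integrable setT (fun x => (`|f x| `^ r)%:E).
Proof.
have muT : mu setT \is a fin_num by exact: fin_num_measure.
move=> p1 fp.
suff [r r1 fr] : exists2 r : R, 1 < r & f \in Lfun mu r%:E.
  exists r => //; split; last by apply: Lfun_integrable => //; exact: ltW.
  apply/Lfun1_integrable.
  by apply: (Lfun_subset _ _ muT _ fr) => //; rewrite lee_fin ltW.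
case: p p1 fp => [r r1 fr|_ fp|//]; first by exists r.
exists 2; first by rewrite ltr1n.
by apply: (Lfun_subset _ _ muT _ fp) => //; rewrite ?lee_fin ?ler1n ?leey.
Qed.

Lemma geometric_nneseries (R : realType) (c q : R) :
  0 <= c -> 0 <= q -> q < 1 ->
  (\sum_(j <oo) (c * q ^+ j)%:E <= (c / (1 - q))%:E)%E.
Proof.
move=> c0 q0 q1; have cq0 j : 0 <= c * q ^+ j by rewrite mulr_ge0// exprn_ge0.
apply: lime_le; first by apply: is_cvg_nneseries => j _ _; rewrite lee_fin.
apply: nearW => n; rewrite sumEFin lee_fin -mulr_sumr ler_wpM2l//.
rewrite -[leRHS]mul1r ler_pdivlMr ?subr_gt0// mulrC big_mkord.
rewrite -[leLHS]opprK -mulNr opprB -subrX1 opprB.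
by rewrite lerBlDr lerDl exprn_ge0.
Qed.

Section integrable_maximal_function.
Context d (X : measurableType d) (R : realType) (mu : probability X R).
Context (T : X -> X).
Hypothesis mpT : measure_preserving mu T.

Let L1 (phi : X -> R) := mu.-integrable setT (EFin \o phi).

Definition max_average (f : X -> R) (x : X) : \bar R :=
  esups (fun k => (time_average T (fun y => `|f y|) k x)%:E) 0.

Lemma time_average_le_max (f : X -> R) k x :
  ((time_average T (fun y => `|f y|) k x)%:E <= max_average f x)%E.
Proof. by apply: ereal_sup_ubound; exists k. Qed.

Lemma max_average_ge0 (f : X -> R) x : (0 <= max_average f x)%E.
Proof.
apply: le_trans (time_average_le_max f 0 x).
by rewrite /time_average invr0 mul0r.
Qed.

Lemma measurable_max_average (f : X -> R) : measurable_fun setT f ->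
  measurable_fun setT (max_average f).
Proof.
move=> mf; apply: measurable_fun_esups => k; apply/measurable_EFinP.
by apply: (measurable_time_average mpT); exact: measurableT_comp.
Qed.

Lemma dyadic_sum_ge (t : R) : exists J : nat,
  t <= 2 + \sum_(j < J) 2 ^+ j.+1 /\ forall j, (j < J)%N -> 2 ^+ j.+1 < t.
Proof.
pose P j := t <= 2 ^+ j.+1.
have exP : exists j, P j.
  have [n _ Hn] := nbhs_infty_ger t; exists n.
  apply: (le_trans (Hn n _)) => //=; rewrite -natrX ler_nat.
  by rewrite (leq_trans (ltnW (ltn_expl n (ltnSn 1))))// leq_exp2l.
case: (ex_minnP exP) => J PJ minJ; exists J; split.
  have -> : 2 + \sum_(j < J) 2 ^+ j.+1 = 2 ^+ J.+1 :> R; last exact: PJ.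
  elim: J {PJ minJ} => [|J IH]; first by rewrite big_ord0 addr0 expr1.
  by rewrite big_ord_recr/= addrA IH [RHS]exprS mulr_natl.
move=> j jJ; rewrite ltNge; apply/negP => /minJ; by rewrite leqNgt jJ.
Qed.

(** The maximal function is cut at the heights [2 ^ j.+1]: by the maximal
inequality, [2 ^ j.+1] times the measure of the set where it exceeds this height
is at most twice the integral of [|f|] over [|f| > 2 ^ j].  There [|f|] is at
most [|f| `^ r / b ^+ j] with [b = 2 `^ (r - 1) > 1], so the bounds form a
geometric series. *)
Lemma integrable_max_average (f : X -> R) (r : R) : 1 < r -> L1 f ->
  mu.-integrable setT (fun x => (`|f x| `^ r)%:E) ->
  mu.-integrable setT (max_average f).
Proof.
move=> r1 iff ifr; have mf := L1_measurable iff.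
pose g x : R := `|f x|; have g0 x : 0 <= g x by exact: normr_ge0.
have ig : L1 g by exact: integrable_norm.
have mg := L1_measurable ig.
pose L j := [set x | exists k, 2 ^+ j.+1 < time_average T g k x].
pose b : R := 2 `^ (r - 1).
have r10 : 0 < r - 1 by rewrite subr_gt0.
have b1 : 1 < b.
  rewrite /b -[ltLHS](_ : 1 `^ (r - 1) = 1); last by rewrite powR1.
  by apply: (gt0_ltr_powR r10); rewrite ?nnegrE ?ltr1n.
have b0 : 0 < b by rewrite (lt_trans ltr01).
have HL j : measurable (L j) /\
    ((2 ^+ j.+1)%:E * mu (L j) <=
     2%:E * (\int[mu]_x (g x `^ r)%:E * (b^-1 ^+ j)%:E))%E.
  have c0 : 0 < 2 ^+ j :> R by rewrite exprn_gt0.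
  have := maximal_inequality mpT ig g0 c0.
  rewrite -exprS; move=> /= -[mL HL]; split => //.
  rewrite exprS EFinM -muleA lee_pmul2l//; apply: (le_trans HL).
  have mA : measurable [set x | 2 ^+ j < g x] by exact: measurable_superlevel.
  have q0 : (0 <= (b^-1 ^+ j)%:E)%E by rewrite lee_fin exprn_ge0// invr_ge0 ltW.
  rewrite -ge0_integralZr//; last 2 first.
  - by case/integrableP : ifr.
  - by move=> x _; rewrite lee_fin powR_ge0.
  rewrite [leLHS]integral_mkcond; apply: ge0_le_integral => //.
  - by move=> x _; rewrite patchE; case: ifP => //; rewrite lee_fin.
  - apply/(measurable_restrictT _ _).1 => //.
    by apply/measurable_EFinP; exact: measurable_funTS.
  - by apply: emeasurable_funM => //; case/integrableP : ifr.
  move=> x _; rewrite patchE; case: ifPn => [|_]; last first.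
    by rewrite mule_ge0// lee_fin powR_ge0.
  rewrite in_setE /= => gx; rewrite -EFinM lee_fin exprVn.
  rewrite ler_pdivlMr ?exprn_gt0//.
  rewrite -(mulr_powRB1 (g0 x) (lt_trans ltr01 r1)) ler_wpM2l//.
  have -> : b ^+ j = (2 ^+ j) `^ (r - 1).
    by rewrite -!powR_mulrn ?(ltW b0)// /b powRAC.
  by apply/ltW/(gt0_ltr_powR r10); rewrite ?nnegrE//; exact: ltW.
apply/integrableP; split; first exact: measurable_max_average.
under eq_integral do rewrite gee0_abs ?max_average_ge0//.
pose D x : \bar R := (2%:E + \sum_(j <oo) (2 ^+ j.+1 * \1_(L j) x)%:E)%E.
have D0 j x : (0 <= (2 ^+ j.+1 * \1_(L j) x : R)%:E)%E.
  by rewrite lee_fin mulr_ge0// exprn_ge0.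
have mD j : measurable_fun setT (fun x => (2 ^+ j.+1 * \1_(L j) x : R)%:E).
  apply/measurable_EFinP/measurable_funM; first exact: measurable_cst.
  by apply: measurable_indic; have [] := HL j.
have maxD x : (max_average f x <= D x)%E.
  apply: ub_ereal_sup => _ [k _ <-] /=.
  have [J [tJ HJ]] := dyadic_sum_ge (time_average T g k x).
  apply: (@le_trans _ _ (2 + \sum_(j < J) 2 ^+ j.+1)%:E).
    by rewrite lee_fin.
  rewrite EFinD /D leeD2l// -sumEFin.
  apply: (@le_trans _ _ (\sum_(0 <= j < J) (2 ^+ j.+1 * \1_(L j) x)%:E)%E).
    rewrite big_mkord; apply: lee_sum => j _.
    rewrite indicE mem_set ?mulr1//; exists k; exact: HJ.
  by apply: nneseries_lim_ge => j _ _; exact: D0.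
apply: (@le_lt_trans _ _ (\int[mu]_x D x)%E).
  apply: ge0_le_integral => //.
  - by move=> x _; exact: max_average_ge0.
  - exact: measurable_max_average.
  - by apply: emeasurable_funD => //; apply: ge0_emeasurable_sum.
rewrite ge0_integralD//; last 2 first.
- by move=> x _; apply: nneseries_ge0.
- by apply: ge0_emeasurable_sum.
rewrite integral_nneseries//.
apply: lte_add_pinfty.
  apply: (@integrable_lty _ _ _ mu setT measurableT (EFin \o cst 2)).
  exact: finite_measure_integrable_cst.
pose I := (\int[mu]_x (g x `^ r)%:E)%E.
have Ifin : I \is a fin_num by exact: (integrable_fin_num measurableT ifr).
have I0 : 0 <= fine I.
  by apply/fine_ge0/integral_ge0 => x _; rewrite lee_fin powR_ge0.
apply: (@le_lt_trans _ _ (\sum_(j <oo) ((2 * fine I) * b^-1 ^+ j)%:E)%E).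
  apply: lee_nneseries => j _; first by move=> _; exact: integral_ge0.
  have [mL HLj] := HL j.
  rewrite (@integralZl_indic _ _ _ mu setT measurableT (fun=> L j))//;
    last first.
    by rewrite ltNge exprn_ge0.
  rewrite integral_indic// setIT; apply: (le_trans HLj).
  by rewrite 2!EFinM fineK// muleA.
apply: (le_lt_trans (geometric_nneseries _ _ _)); last exact: ltry.
- by rewrite mulr_ge0.
- by rewrite invr_ge0 ltW.
- by rewrite invf_lt1.
Qed.

End integrable_maximal_function.

(** * Birkhoff's pointwise ergodic theorem *)

Section birkhoff.
Context d (X : measurableType d) (R : realType) (mu : probability X R).
Context (T : X -> X).
Hypothesis mpT : measure_preserving mu T.

Let L1 (phi : X -> R) := mu.-integrable setT (EFin \o phi).

(** For [phi = f - c] this set lies between [c < limsup A_k f] and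
[c <= limsup A_k f].  It is preferred to both because the orbit sums at [x] and
at [T x] differ by a bounded amount, so that it is invariant without any
exceptional null set. *)
Definition unbounded (phi : X -> R) :=
  [set x | forall m : nat, exists k, m%:R < orbit_sum T phi k x].

Lemma unbounded_invariant (phi : X -> R) :
  T @^-1` unbounded phi = unbounded phi.
Proof.
have small (t : R) : exists n : nat, t <= n%:R.
  by have [n _ Hn] := nbhs_infty_ger t; exists n; exact: Hn (leqnn n).
apply/seteqP; split => x /= H m.
  have [n Hn] := small (m%:R - phi x).
  have [k Hk] := H n; exists k.+1.
  by rewrite orbit_sumS; lra.
have [n Hn] := small (m%:R + `|phi x|).
have [[|k] Hk] := H n.
  move: Hk; rewrite /orbit_sum big_ord0 => /(le_lt_trans Hn).
  by rewrite ltNge addr_ge0.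
exists k; move: Hk; rewrite orbit_sumS.
have := ler_norm (phi x); lra.
Qed.

Lemma measurable_unbounded (phi : X -> R) : measurable_fun setT phi ->
  measurable (unbounded phi).
Proof.
move=> mphi; rewrite (_ : unbounded phi =
    \bigcap_m \bigcup_k [set x | m%:R < orbit_sum T phi k x]).
  apply: bigcapT_measurable => m; apply: bigcupT_measurable => k.
  exact/measurable_superlevel/(measurable_orbit_sum mpT).
by apply/seteqP; split => x H m; [move=> _|]; have [] := H m => // k;
  [exists k|move=> _; exists k].
Qed.

Lemma orbit_sumB_cst (phi : X -> R) (c : R) k x :
  orbit_sum T (fun y => phi y - c) k x = orbit_sum T phi k x - k%:R * c.
Proof. by rewrite /orbit_sum sumrB sumr_const card_ord mulr_natl. Qed.

Lemma orbit_sum_average (phi : X -> R) k x :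
  orbit_sum T phi k x = k%:R * time_average T phi k x.
Proof.
case: k => [|k]; first by rewrite /orbit_sum big_ord0 mul0r.
by rewrite time_averageE mulVKf.
Qed.

Lemma frequently_unbounded (phi : X -> R) (b c : R) x : c < b ->
  (forall N, exists2 k, (N <= k)%N & b < time_average T phi k x) ->
  unbounded (fun y => phi y - c) x.
Proof.
move=> cb H m; have bc0 : 0 < b - c by rewrite subr_gt0.
have [N _ HN] := nbhs_infty_ger (m%:R / (b - c)).
have [k Nk bk] := H N.+1; exists k.
rewrite orbit_sumB_cst orbit_sum_average -mulrBr.
have k0 : 0 < k%:R :> R by rewrite ltr0n (leq_trans _ Nk).
apply: (@le_lt_trans _ _ (k%:R * (b - c))); last by rewrite ltr_pM2l// ltrD2r.
by rewrite -ler_pdivrMr//; apply: HN => /=; exact: ltnW.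
Qed.

Lemma cvg_unbounded (phi : X -> R) (l c : R) x :
  time_average T phi k x @[k --> \oo] --> l -> c < l ->
  unbounded (fun y => phi y - c) x.
Proof.
move=> cl cltl; apply: (@frequently_unbounded _ ((c + l) / 2)); first by lra.
have cl2 : (c + l) / 2 < l by lra.
have [N _ HN] : \forall k \near \oo, (c + l) / 2 < time_average T phi k x.
  exact: (cvgr_gt l cl).
move=> M; exists (maxn M N); first exact: leq_maxl.
by apply: HN => /=; exact: leq_maxr.
Qed.

Lemma unbounded_cvg (phi : X -> R) (l c : R) x :
  time_average T phi k x @[k --> \oo] --> l ->
  unbounded (fun y => phi y - c) x -> c <= l.
Proof.
move=> cl H; rewrite leNgt; apply/negP => lc.
have [N _ HN] : \forall k \near \oo, time_average T phi k x < c.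
  exact: (cvgr_lt l cl).
pose S k := orbit_sum T (fun y => phi y - c) k x.
have [M HM] : exists M : nat, forall k, (k < N)%N -> S k <= M%:R.
  elim: N {HN} => [|N [M HM]]; first by exists 0%N.
  have [n _ /(_ _ (leqnn n))/= Hn] := nbhs_infty_ger (S N).
  exists (maxn M n) => k; rewrite ltnS leq_eqVlt => /predU1P[->|/HM kM].
    by rewrite (le_trans Hn)// ler_nat leq_maxr.
  by rewrite (le_trans kM)// ler_nat leq_maxl.
have [k kM] := H M; have [kN|Nk] := ltnP k N.
  by move: kM; rewrite ltNge => /negP; apply; exact: HM.
move: kM; rewrite ltNge => /negP; apply.
rewrite orbit_sumB_cst orbit_sum_average -mulrBr.
apply: (@le_trans _ _ 0) => //.
by rewrite mulr_ge0_le0// subr_le0 ltW// HN.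
Qed.

Lemma invariant_iter (Z : set X) :
  T @^-1` Z = Z -> forall j x, Z (iter j T x) = Z x.
Proof.
by move=> TZ; elim=> //= j IH x; rewrite -[X in _ = X]IH -[in RHS]TZ.
Qed.

(** The maximal ergodic theorem for [phi] cut off outside [E]: as [E] is
invariant, the cut-off function has a positive orbit sum exactly on [E]. *)
Lemma invariant_ups_integral (phi : X -> R) (E : set X) : L1 phi ->
  measurable E -> T @^-1` E = E -> E `<=` ups T phi ->
  (0 <= \int[mu]_(x in E) (phi x)%:E)%E.
Proof.
move=> iphi mE TE Eups.
have ips : L1 (phi \_ E).
  rewrite /L1 -restrict_EFin.
  by apply/(integrable_mkcond _ _).1 => //; exact: integrableS iphi.
have Eit x j : E (iter j T x) = E x by exact: invariant_iter.
have EE : ups T (phi \_ E) = E.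
  apply/seteqP; split => x; last first.
    move=> Ex; have [k k0] := Eups _ Ex; exists k; move: k0.
    rewrite /orbit_sum; under [in X in _ -> X]eq_bigr => j _.
      by rewrite patchE mem_set ?Eit//; over.
    by [].
  move=> [k]; apply: contraPP => nEx; rewrite /orbit_sum big1 ?ltxx// => j _.
  by rewrite patchE memNset// Eit.
have := maximal_ergodic mpT ips; rewrite EE.
suff -> : (\int[mu]_(x in E) ((phi \_ E) x)%:E =
  \int[mu]_(x in E) (phi x)%:E)%E by [].
by apply: eq_integral => x xE; rewrite patchE xE.
Qed.

(** On this invariant set both [f - b] and [a - f] have a nonnegative integral,
hence so does their sum, the negative constant [a - b]. *)
Lemma no_oscillation (f : X -> R) (a b : R) : L1 f -> a < b ->
  mu (unbounded (fun y => f y - b) `&` unbounded (fun y => a - f y)) = 0%E.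
Proof.
move=> iff ab; set E := _ `&` _.
have icst (c : R) (D : set X) :
    measurable D -> mu.-integrable D (EFin \o cst c).
  by move=> mD; exact: finite_measure_integrable_cst.
have icT c := icst c setT measurableT.
have i1 : L1 (f \- cst b).
  exact: (@integrableB _ _ _ mu setT measurableT _ _ iff (icT b)).
have i2 : L1 (cst a \- f).
  exact: (@integrableB _ _ _ mu setT measurableT _ _ (icT a) iff).
have mE : measurable E.
  apply: measurableI; apply: measurable_unbounded.
    exact: L1_measurable i1.
  exact: L1_measurable i2.
have TE : T @^-1` E = E by rewrite /E preimage_setI !unbounded_invariant.
have unb_ups (phi : X -> R) : unbounded phi `<=` ups T phi.
  by move=> x /(_ 0%N)[k k0]; exists k.
have iE phi : L1 phi -> mu.-integrable E (EFin \o phi) by exact: integrableS.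
have := @invariant_ups_integral _ _ i1 mE TE (fun x Ex => unb_ups _ x Ex.1).
rewrite (integralB_EFin mE (iE _ iff) (icst b E mE)).
have := @invariant_ups_integral _ _ i2 mE TE (fun x Ex => unb_ups _ x Ex.2).
rewrite (integralB_EFin mE (icst a E mE) (iE _ iff)).
have cE (c : R) : (\int[mu]_(x in E) (cst c x)%:E = c%:E * mu E)%E.
  exact: (integral_cst mu mE c%:E).
rewrite !cE -(fineK (integrable_fin_num mE (iE _ iff))).
rewrite -(fineK (fin_num_measure mu _ mE)) -!EFinM -!EFinB !lee_fin => h1 h2.
have h0 : 0 <= fine (mu E) by exact: fine_ge0.
congr (_%:E); apply/eqP; rewrite eq_le h0 andbT.
rewrite -(@pmulr_rle0 _ (b - a)) ?subr_gt0//; lra.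
Qed.

Lemma averages_bounded_ae (f : X -> R) : L1 f ->
  {ae mu, forall x, exists c, forall k, `|time_average T f k x| <= c}.
Proof.
move=> iff; pose g x : R := `|f x|.
have ig : L1 g by exact: integrable_norm.
pose I := fine (\int[mu]_x (g x)%:E).
have I0 : 0 <= I.
  by apply/fine_ge0/integral_ge0 => x _; rewrite lee_fin normr_ge0.
apply: negligible_small => e e0.
have c0 : 0 < (I + 1) / e by rewrite divr_gt0// ltr_wpDl.
have [mE HE] := maximal_inequality mpT ig (fun x => normr_ge0 (f x)) c0.
set E := [set x | _] in mE HE; exists E; split => //.
  move=> x /= nx; apply: contrapT => nEx; apply: nx.
  exists (2 * ((I + 1) / e)) => k.
  have gk : time_average T g k x <= 2 * ((I + 1) / e).
    by rewrite leNgt; apply/negP => h; apply: nEx; exists k.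
  apply: le_trans gk; rewrite /time_average normrM ger0_norm ?invr_ge0//.
  by rewrite ler_wpM2l ?invr_ge0// ler_norm_sum.
rewrite -(@lee_pmul2l _ ((I + 1) / e)%:E)// (le_trans HE)//.
rewrite -EFinM divfK ?gt_eqF//.
apply: (@le_trans _ _ (\int[mu]_x (g x)%:E)%E).
  apply: ge0_subset_integral => //.
  - apply: measurable_superlevel; exact: L1_measurable ig.
  - by case/integrableP : ig.
  - by move=> x _; rewrite lee_fin normr_ge0.
by rewrite -(fineK (integrable_fin_num measurableT ig)) lee_fin lerDl.
Qed.

(** The limit is the supremum of the levels exceeded infinitely often. *)
Lemma bounded_no_oscillation_cvg (u : nat -> R) (c : R) :
  (forall k, `|u k| <= c) ->
  (forall a b : rat, a < b ->
    ~ ((forall N, exists2 k, (N <= k)%N & ratr b < u k) /\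
       (forall N, exists2 k, (N <= k)%N & u k < ratr a))) ->
  cvgn u.
Proof.
move=> uc osc.
pose S := [set y | forall N, exists2 k, (N <= k)%N & y < u k].
have S0 : S (- c - 1).
  move=> N; exists N => //; have := uc N; rewrite ler_norml => /andP[h _].
  by rewrite (lt_le_trans _ h)// ltrBlDr ltrDl.
have Sc : ubound S c.
  move=> y /(_ 0%N)[k _ /ltW yu]; apply: (le_trans yu).
  by apply: le_trans (uc k); exact: ler_norm.
have supS : has_sup S by split; [exists (- c - 1)|exists c].
apply/cvg_ex; exists (sup S); apply/cvgrPdist_le => e e0.
have [y Sy ye] := sup_adherent (divr_gt0 e0 (ltr0n _ 2)) supS.
have [b] := rat_in_itvoo ye; rewrite in_itv/= => /andP[eb by_].
have ab : sup S - e < sup S - e / 2 by lra.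
have [a] := rat_in_itvoo ab; rewrite in_itv/= => /andP[ea ab2].
have Sb N : exists2 k, (N <= k)%N & ratr b < u k.
  by have [k Nk yk] := Sy N; exists k => //; exact: lt_trans yk.
have [N1 HN1] : exists N, forall k, (N <= k)%N -> ratr a <= u k.
  apply: contrapT => h; apply: (osc a b).
    by rewrite -(ltr_rat R) (lt_trans ab2).
  split => // N; apply: contrapT => h'; apply: h; exists N => k Nk.
  by rewrite leNgt; apply/negP => uk; apply: h'; exists k.
have [N2 HN2] : exists N, forall k, (N <= k)%N -> u k <= sup S + e.
  apply: contrapT => h; have : S (sup S + e).
    move=> N; apply: contrapT => h'; apply: h; exists N => k Nk.
    by rewrite leNgt; apply/negP => uk; apply: h'; exists k.
  by move/(sup_upper_bound supS); rewrite gerDl leNgt e0.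
exists (maxn N1 N2) => // k /=; rewrite geq_max => /andP[k1 k2].
have := HN1 _ k1; have := HN2 _ k2; rewrite ler_distl; move: ea; lra.
Qed.

(** An oscillation across the interval from [a] to [b] is first moved to an
interval strictly inside, as [frequently_unbounded] needs some room; rational
endpoints leave countably many exceptional sets. *)
Lemma birkhoff_cvg (f : X -> R) : L1 f ->
  {ae mu, forall x, cvgn (fun k => time_average T f k x)}.
Proof.
move=> iff.
have osc : {ae mu, forall x, forall n : nat,
    if (unpickle n : option (rat * rat)) is Some (a, b) then (a < b)%R ->
      ~ (unbounded (fun y => f y - ratr b) x /\
         unbounded (fun y => ratr a - f y) x) else True}.
  apply/ae_foralln => n.
  case: (unpickle n : option (rat * rat)) => [[a b]|]; last exact: aeW.
  have [ab|_] := ltP a b; last exact: aeW.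
  have ab' : (ratr a : R) < ratr b by rewrite ltr_rat.
  have := no_oscillation iff ab'.
  set E := _ `&` _ => E0; have mE : measurable E.
    apply: measurableI; apply: measurable_unbounded.
      by apply: measurable_funB;
        [exact: L1_measurable iff|exact: measurable_cst].
    by apply: measurable_funB; [exact: measurable_cst|exact: L1_measurable iff].
  exists E; split => // x /= nx; apply: contrapT => nE; apply: nx => _ [h1 h2].
  exact: nE.
apply: filterS2 (averages_bounded_ae iff) osc => x [c Hc] Hosc.
apply: (bounded_no_oscillation_cvg Hc) => a b ab [Hb Ha].
have := Hosc (pickle ((2 * a + b) / 3, (a + 2 * b) / 3)); rewrite pickleK.
apply; first by lra.
split.
  by apply: (frequently_unbounded _ Hb); rewrite ltr_rat; lra.
rewrite (_ : (fun y => _) = (fun y => (\- f) y - - ratr ((2 * a + b) / 3))).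
  apply: (@frequently_unbounded _ (- ratr a)).
    by rewrite ltrN2 ltr_rat; lra.
  move=> N; have [k Nk ka] := Ha N; exists k => //.
  by rewrite /time_average sumrN mulrN ltrN2.
by apply/funext => y; rewrite opprK addrC.
Qed.

(** The upper limit is measurable whether or not the averages converge, and it
is their limit where they do. *)
Definition birkhoff_limit (f : X -> R) (x : X) : R :=
  fine (limn_esup (fun k => (time_average T f k x)%:E)).

Lemma measurable_birkhoff_limit f : measurable_fun setT f ->
  measurable_fun setT (birkhoff_limit f).
Proof.
move=> mf; apply: measurableT_comp => //; apply: measurable_fun_limn_esup => k.
by apply/measurable_EFinP; exact: (measurable_time_average mpT).
Qed.

Lemma birkhoff_limitE (f : X -> R) (l : R) x :
  time_average T f k x @[k --> \oo] --> l -> birkhoff_limit f x = l.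
Proof.
move=> fl; rewrite /birkhoff_limit.
have fl' : (time_average T f k x)%:E @[k --> \oo] --> l%:E.
  by apply: cvg_EFin; [exact: nearW|exact: fl].
by have [_ ->] := cvg_limn_einf_sup fl'.
Qed.

Lemma integral_mean (psi_ : nat -> X -> R) (I : \bar R) (k : nat) :
  (forall j, L1 (psi_ j) /\ (\int[mu]_x (psi_ j x)%:E)%E = I) ->
  L1 (fun x => k.+1%:R^-1 * \sum_(j < k.+1) psi_ j x) /\
  (\int[mu]_x (k.+1%:R^-1 * \sum_(j < k.+1) psi_ j x)%:E)%E = I.
Proof.
move=> H.
have iS : mu.-integrable setT (fun x => \sum_(j < k.+1) (psi_ j x)%:E)%E.
  by apply: integrable_sum => // j _; have [] := H j.
have E : (fun x => (k.+1%:R^-1 * \sum_(j < k.+1) psi_ j x)%:E) =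
    (fun x => (k.+1%:R^-1)%:E * \sum_(j < k.+1) (psi_ j x)%:E)%E.
  by apply/funext => x; rewrite sumEFin.
split; first by rewrite /L1 [EFin \o _]E; exact: integrableZl.
rewrite E integralZl// integral_sum//; last by move=> j; have [] := H j.
have Ifin : I \is a fin_num.
  by have [i0 <-] := H 0%N; exact: (integrable_fin_num measurableT i0).
rewrite (eq_bigr (fun=> (fine I)%:E)); last first.
  by move=> j _; rewrite (H j).2 fineK.
rewrite sumEFin sumr_const card_ord -EFinM -(mulr_natl (fine I)).
by rewrite mulKf// fineK.
Qed.

Lemma integral_time_average (phi : X -> R) k : L1 phi ->
  (\int[mu]_x (time_average T phi k.+1 x)%:E = \int[mu]_x (phi x)%:E)%E.
Proof.
move=> iphi; have [_ +] := @integral_mean (fun j => phi \o iter j T)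
  (\int[mu]_x (phi x)%:E)%E k (fun j => integral_iter mpT j iphi).
by [].
Qed.

Lemma integral_time_average_invariant (f : X -> R) (Z : set X) k : L1 f ->
  measurable Z -> T @^-1` Z = Z ->
  (\int[mu]_(x in Z) (time_average T f k.+1 x)%:E =
   \int[mu]_(x in Z) (f x)%:E)%E.
Proof.
move=> iff mZ TZ; rewrite integral_mkcond [RHS]integral_mkcond.
have ifZ : L1 (f \_ Z).
  rewrite /L1 -restrict_EFin.
  by apply/(integrable_mkcond _ _).1 => //; exact: integrableS iff.
rewrite !restrict_EFin -[RHS](integral_time_average k ifZ).
apply: eq_integral => x _ /=; congr (_%:E).
rewrite patchE /time_average.
case: ifPn => [|]; rewrite ?in_setE ?notin_setE => xZ.
  congr (_ * _); apply: eq_bigr => j _.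
  by rewrite patchE mem_set// invariant_iter.
by rewrite big1 ?mulr0// => j _; rewrite patchE memNset// invariant_iter.
Qed.

Lemma birkhoff_limit_ae (f : X -> R) : L1 f ->
  {ae mu, forall x, time_average T f k x @[k --> \oo] --> birkhoff_limit f x}.
Proof.
by move=> iff; apply: filterS (birkhoff_cvg iff) => x /cvg_ex[l fl];
  rewrite (birkhoff_limitE fl).
Qed.

Lemma birkhoff_limit_invariant (f : X -> R) : L1 f ->
  {ae mu, forall x, birkhoff_limit f (T x) = birkhoff_limit f x}.
Proof.
move=> iff; apply: filterS (birkhoff_limit_ae iff) => x fl.
apply: birkhoff_limitE; set l := birkhoff_limit f x in fl *.
rewrite -cvg_shiftS/=.
have -> : (fun k => time_average T f k.+1 (T x)) =
    (fun k => (1 + k.+1%:R^-1) * time_average T f k.+2 x - k.+1%:R^-1 * f x).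
  apply/funext => k; rewrite !time_averageE orbit_sum_comp.
  have k1 : k.+1%:R != 0 :> R by rewrite pnatr_eq0.
  have k2 : k.+2%:R != 0 :> R by rewrite pnatr_eq0.
  rewrite -[k.+2%:R]natr1 in k2 *; field.
  by rewrite nat1r k1 k2.
suff : (1 + k.+1%:R^-1) * time_average T f k.+2 x - k.+1%:R^-1 * f x
    @[k --> \oo] --> (1 + 0) * l - 0 * f x by rewrite addr0 mul1r mul0r subr0.
have c0 := @cvg_harmonic R.
apply: cvgB; last by apply: cvgM => //; exact: cvg_cst.
apply: cvgM; first by apply: cvgD => //; exact: cvg_cst.
rewrite (cvg_shiftS (fun k => time_average T f k.+1 x)).
by rewrite (cvg_shiftS (fun k => time_average T f k x)).
Qed.

Lemma time_average_le_maxe (f : X -> R) k x :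
  (`|(time_average T f k x)%:E| <= max_average T f x)%E.
Proof.
apply: le_trans (time_average_le_max T f k x).
rewrite lee_fin /time_average normrM ger0_norm ?invr_ge0//.
by rewrite ler_wpM2l ?invr_ge0// ler_norm_sum.
Qed.

(** The time averages have the same integral as [f] over an invariant set, and
an integrable maximal function lets this pass to the limit. *)
Lemma birkhoff_limit_dominated (f : X -> R) : L1 f ->
  mu.-integrable setT (max_average T f) ->
  L1 (birkhoff_limit f) /\
  forall Z, measurable Z -> T @^-1` Z = Z ->
    (\int[mu]_(x in Z) (birkhoff_limit f x)%:E = \int[mu]_(x in Z) (f x)%:E)%E.
Proof.
move=> iff iM; have mf := L1_measurable iff.
have dc Z : measurable Z -> mu.-integrable Z (EFin \o birkhoff_limit f) /\
    (\int[mu]_(x in Z) (time_average T f k x)%:E)%E @[k --> \oo] -->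
    (\int[mu]_(x in Z) (birkhoff_limit f x)%:E)%E.
  move=> mZ; have [] // := @dominated_convergence _ _ _ mu Z mZ
    (fun k => EFin \o time_average T f k) (EFin \o birkhoff_limit f)
    (max_average T f).
  - move=> k; apply/measurable_EFinP/measurable_funTS.
    exact: (measurable_time_average mpT).
  - apply/measurable_EFinP/measurable_funTS; exact: measurable_birkhoff_limit.
  - apply: filterS (birkhoff_limit_ae iff) => x fl _.
    by apply: cvg_EFin; [exact: nearW|exact: fl].
  - exact: integrableS iM.
  - by apply: aeW => x k _; exact: time_average_le_maxe.
split; first by have [] := dc setT measurableT.
move=> Z mZ TZ; have [_] := dc Z mZ; rewrite -cvg_shiftS/=.
rewrite (_ : (fun k => _) = cst (\int[mu]_(x in Z) (f x)%:E)%E); last first.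
  by apply/funext => k; exact: integral_time_average_invariant.
by move=> /(cvg_lim (@ereal_hausdorff R)) <-; rewrite lim_cst.
Qed.

End birkhoff.

(** * Invariant functions seen from a sub-sigma-algebra stable under preimage *)

Section factor.
Context d (X : measurableType d) (R : realType) (mu : probability X R).
Context (T : X -> X).
Hypothesis mpT : measure_preserving mu T.

Let L1 (phi : X -> R) := mu.-integrable setT (EFin \o phi).

Lemma ae_iter (P : X -> Prop) j :
  {ae mu, forall x, P x} -> {ae mu, forall x, P (iter j T x)}.
Proof.
move=> aeP; elim: j => [//|j [N [mN N0 HN]]]; exists (T @^-1` N); split.
- by rewrite -[_ @^-1` _]setTI; case: mpT => mT _; exact: mT.
- by case: mpT => _ ->.
- by move=> x /= nP; apply: HN; rewrite /= -iterSr.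
Qed.

Lemma invariant_iter_ae (H : X -> R) : {ae mu, forall x, H (T x) = H x} ->
  {ae mu, forall x, forall j, H (iter j T x) = H x}.
Proof.
move=> HT; have /ae_foralln := fun j => ae_iter j HT.
by apply: filterS => x Hx; elim=> // j <-; rewrite -[RHS]Hx.
Qed.

Context (FF : set (set X)).
Hypothesis sFF : sigma_algebra setT FF.
Hypothesis FFm : FF `<=` measurable.
Hypothesis FFT : forall A, FF A -> FF (T @^-1` A).

Lemma sigma_setC A : FF A -> FF (~` A).
Proof. by case: sFF => _ + _ => /[apply]; rewrite setTD. Qed.

Lemma sigma_bigcup (A : nat -> set X) :
  (forall n, FF (A n)) -> FF (\bigcup_n A n).
Proof. by case: sFF => _ _; exact. Qed.

Lemma sigma_bigcap (A : nat -> set X) :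
  (forall n, FF (A n)) -> FF (\bigcap_n A n).
Proof.
move=> FA; rewrite -[X in FF X]setCK setC_bigcap; apply: sigma_setC.
by apply: sigma_bigcup => n; exact: sigma_setC.
Qed.

Lemma sigma_setI A B : FF A -> FF B -> FF (A `&` B).
Proof.
move=> FA FB; rewrite -bigcap2E; apply: sigma_bigcap => -[|[|n]] //=.
by rewrite -setC0; apply: sigma_setC; case: sFF.
Qed.

Lemma sigma_setU A B : FF A -> FF B -> FF (A `|` B).
Proof.
move=> FA FB; rewrite -[X in FF X]setCK setCU; apply: sigma_setC.
by apply: sigma_setI; exact: sigma_setC.
Qed.

Lemma sigma_iter A j : FF A -> FF (iter j T @^-1` A).
Proof.
move=> FA; elim: j => [//|j IH].
rewrite (_ : _ @^-1` A = T @^-1` (iter j T @^-1` A)); first exact: FFT.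
by apply/seteqP; split => x /=; rewrite -iterSr.
Qed.

(** Induction on [k], splitting on whether the last point of the orbit is in
[B]. *)
Lemma sigma_orbit_sum B (c : R) k : FF B ->
  FF [set x | c < orbit_sum T (\1_B : X -> R) k x].
Proof.
move=> FB; elim: k c => [|k IH] c.
  rewrite [X in FF X](_ : _ = if c < 0 then setT else set0).
    by case: ifP => _; [rewrite -setC0; apply: sigma_setC|]; case: sFF.
  by apply/seteqP; split => x; rewrite /orbit_sum /= big_ord0; case: ifP.
rewrite [X in FF X](_ : _ =
  ((iter k T @^-1` B) `&` [set x | c - 1 < orbit_sum T (\1_B : X -> R) k x]) `|`
  (~` (iter k T @^-1` B) `&` [set x | c < orbit_sum T (\1_B : X -> R) k x])).
  apply: sigma_setU; apply: sigma_setI => //; first exact: sigma_iter.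
  exact/sigma_setC/sigma_iter.
apply/seteqP; split => x /=; rewrite /orbit_sum big_ord_recr/= indicE.
  have [xB|xB] := pselect (B (iter k T x)).
    by rewrite mem_set//= => h; left; rewrite ltrBlDr.
  by rewrite memNset// addr0 => h; right.
by case=> -[xB]; [rewrite mem_set//= ltrBlDr|rewrite memNset// addr0].
Qed.

Lemma sigma_unbounded B (c : R) : FF B ->
  FF (unbounded T (fun y => (\1_B y : R) - c)).
Proof.
move=> FB; rewrite [X in FF X](_ : _ = \bigcap_m \bigcup_k
    [set x | m%:R + k%:R * c < orbit_sum T (\1_B : X -> R) k x]).
  apply: sigma_bigcap => m; apply: sigma_bigcup => k; exact: sigma_orbit_sum.
apply/seteqP; split => x H m.
  by move=> _; have [k] := H m; rewrite orbit_sumB_cst ltrBrDr => h; exists k.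
by have [k _ h] := H m I; exists k; rewrite orbit_sumB_cst ltrBrDr.
Qed.

Lemma integral_indicM (H : X -> R) (B : set X) : L1 H -> measurable B ->
  L1 (fun x => \1_B x * H x) /\
  (\int[mu]_x (\1_B x * H x)%:E = \int[mu]_(x in B) (H x)%:E)%E.
Proof.
move=> iH mB; have E : (fun x => (\1_B x * H x)%:E) = (EFin \o H) \_ B.
  apply/funext => x; rewrite patchE indicE.
  by case: ifP => _; rewrite ?mul1r ?mul0r.
split; last by rewrite E -integral_mkcond.
rewrite /L1 [EFin \o _]E; apply/(integrable_mkcond _ _).1 => //.
exact: integrableS iH.
Qed.

(** Since [H] is invariant, replacing [\1_B] by its time averages, and then by
their limit [lim_phi], does not change the integral against [H].  The sets
[unbounded (\1_B - c)] are invariant members of [FF] and agree almost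
everywhere with the level sets of [lim_phi], except possibly at the value [c];
so they build step functions, orthogonal to [H], within [m.+1%:R^-1] of
[lim_phi]. *)
Lemma invariant_integral0 (H : X -> R) : L1 H ->
  {ae mu, forall x, H (T x) = H x} ->
  (forall Z, FF Z -> T @^-1` Z = Z -> \int[mu]_(x in Z) (H x)%:E = 0)%E ->
  forall B, FF B -> (\int[mu]_(x in B) (H x)%:E = 0)%E.
Proof.
move=> iH HT H0 B FB.
have mH := L1_measurable iH; have mB := FFm FB.
pose phi : X -> R := \1_B.
have iphi : L1 phi by exact: integrable_indic.
have mphi := L1_measurable iphi.
pose lim_phi := birkhoff_limit T phi.
have phi_lim := birkhoff_limit_ae mpT iphi.
have avg01 k x : 0 <= time_average T phi k x <= 1.
  rewrite /time_average; apply/andP; split.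
    by rewrite mulr_ge0 ?invr_ge0// sumr_ge0// => j _; rewrite /phi indicE.
  case: k => [|k]; first by rewrite invr0 mul0r.
  rewrite ler_pdivrMl// mulr1 -[leRHS](_ : \sum_(j < k.+1) 1 = _).
    by apply: ler_sum => j _; rewrite /phi indicE; case: (_ \in _).
  by rewrite sumr_const card_ord.
have [iphiH _] := integral_indicM iH mB.
have step1 k : (\int[mu]_x (time_average T phi k.+1 x * H x)%:E =
    \int[mu]_x (phi x * H x)%:E)%E.
  rewrite -[RHS](integral_time_average mpT k iphiH).
  apply: ae_eq_integral => //.
  - apply/measurable_EFinP; apply: measurable_funM => //.
    exact: (measurable_time_average mpT).
  - apply/measurable_EFinP; apply: (measurable_time_average mpT).
    exact: measurable_funM.
  - apply: filterS (invariant_iter_ae HT) => x Hx _; congr (_%:E).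
    rewrite /time_average -mulrA; congr (_ * _); rewrite mulr_suml.
    by apply: eq_bigr => j _; rewrite Hx.
have [ilimH step2] : L1 (fun x => lim_phi x * H x) /\
    (\int[mu]_x (time_average T phi k x * H x)%:E)%E @[k --> \oo] -->
    (\int[mu]_x (lim_phi x * H x)%:E)%E.
  have [] // := @dominated_convergence _ _ _ mu setT measurableT
    (fun k x => (time_average T phi k x * H x)%:E)
    (fun x => (lim_phi x * H x)%:E) (abse \o (EFin \o H)).
  - move=> k; apply/measurable_EFinP; apply: measurable_funM => //.
    exact: (measurable_time_average mpT).
  - apply/measurable_EFinP; apply: measurable_funM => //.
    exact: (measurable_birkhoff_limit mpT).
  - apply: filterS phi_lim => x xl _; apply: cvg_EFin; first exact: nearW.
    by apply: cvgM => //; exact: cvg_cst.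
  - exact: integrable_abse.
  - apply: aeW => x k _; rewrite /= lee_fin normrM.
    have /andP[a0 a1] := avg01 k x.
    by rewrite ger0_norm// ler_piMl.
have [_ <-] := integral_indicM iH mB.
have -> : (\int[mu]_x (\1_B x * H x)%:E = \int[mu]_x (lim_phi x * H x)%:E)%E.
  move: step2; rewrite -cvg_shiftS/=.
  rewrite (_ : (fun k => _) = cst (\int[mu]_x (phi x * H x)%:E)%E); last first.
    by apply/funext => k; exact: step1.
  by move=> /(cvg_lim (@ereal_hausdorff R)) <-; rewrite lim_cst.
pose Z (m i : nat) := unbounded T (fun y => phi y - i.+1%:R / m.+1%:R).
pose step (m : nat) x : R := m.+1%:R^-1 * \sum_(i < m.+1) (\1_(Z m i) x * H x).
have HZ m i : L1 (fun x => \1_(Z m i) x * H x) /\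
    (\int[mu]_x (\1_(Z m i) x * H x)%:E = 0)%E.
  have FZ : FF (Z m i) by exact: sigma_unbounded.
  have [i1 e1] := integral_indicM iH (FFm FZ); split => //.
  by rewrite e1 H0//; exact: unbounded_invariant.
have Hstep m : L1 (step m) /\ (\int[mu]_x (step m x)%:E = 0)%E.
  exact: (@integral_mean _ _ _ mu (fun i x => \1_(Z m i) x * H x) 0%E m (HZ m)).
have close m : {ae mu, forall x, (setT : set X) x ->
    (`|(lim_phi x * H x)%:E - (step m x)%:E| <=
     (m.+1%:R^-1)%:E * `|(H x)%:E|)%E}.
  apply: filterS phi_lim => x xl _; rewrite -EFinB -EFinM lee_fin.
  have m0 : 0 < m.+1%:R :> R by rewrite ltr0n.
  have l0 : 0 <= lim_phi x.
    by apply: (cvgr_to_ge xl); apply: nearW => k; have /andP[] := avg01 k x.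
  have l1 : lim_phi x <= 1.
    by apply: (cvgr_to_le xl); apply: nearW => k; have /andP[] := avg01 k x.
  have ml0 : 0 <= m.+1%:R * lim_phi x by rewrite mulr_ge0// ltW.
  have [||C1 C2] := @count_levels _ (fun i => x \in Z m i)
    (m.+1%:R * lim_phi x) m.+1 ml0.
  - move=> i iy; rewrite in_setE; apply: (cvg_unbounded xl).
    by rewrite ltr_pdivrMr// mulrC.
  - move=> i; rewrite in_setE => /(unbounded_cvg xl).
    by rewrite ler_pdivrMr// mulrC.
  have stepE : step m x = (m.+1%:R^-1 * \sum_(i < m.+1) (x \in Z m i)%:R) * H x.
    by rewrite /step -mulrA mulr_suml; congr (_ * _).
  rewrite stepE -mulrBl normrM ler_wpM2r//.
  move: C1 C2; set S := \sum_(_ < _) _ => C1 C2.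
  have S1 : m.+1%:R^-1 * S <= lim_phi x by rewrite ler_pdivrMl.
  rewrite ger0_norm ?subr_ge0//.
  have /C2 : m.+1%:R * lim_phi x <= m.+1%:R by rewrite ler_piMr// ltW.
  by rewrite lerBlDr -ler_pdivlMl// mulrDr mulr1 lerBlDr addrC.
set r := (\int[mu]_x (lim_phi x * H x)%:E)%E.
have r_fin : r \is a fin_num by exact: (integrable_fin_num measurableT ilimH).
pose I := (\int[mu]_x `|(H x)%:E|)%E.
have I_fin : I \is a fin_num.
  by apply: integrable_fin_num => //; exact: integrable_abse.
have bound m : `|fine r| <= m.+1%:R^-1 * fine I.
  rewrite -lee_fin EFinM -abse_EFin !fineK// /I -ge0_integralZl//; last first.
    by apply: measurableT_comp => //; exact/measurable_EFinP.
  have [is0 e0] := Hstep m.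
  have -> : r = (\int[mu]_x ((lim_phi x * H x)%:E - (step m x)%:E))%E.
    by rewrite (integralB_EFin measurableT ilimH is0) e0 sube0.
  have mdiff : measurable_fun setT
      (fun x => (lim_phi x * H x)%:E - (step m x)%:E)%E.
    by apply: emeasurable_funB;
      [case/integrableP : ilimH|case/integrableP : is0].
  apply: (le_trans (le_abse_integral mu measurableT mdiff)).
  apply: ae_ge0_le_integral => //.
  - exact: measurableT_comp.
  - apply: measurable_funeM; apply: measurableT_comp => //.
    exact/measurable_EFinP.
rewrite -(fineK r_fin); congr (_%:E); apply/eqP; rewrite -normr_le0.
apply/ler_addgt0Pr => e e0; rewrite add0r.
have : m.+1%:R^-1 * fine I @[m --> \oo] --> 0 * fine I.
  by apply: cvgM; [exact: cvg_harmonic|exact: cvg_cst].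
rewrite mul0r => /cvgrPdist_le/(_ _ e0)[m _ /(_ _ (leqnn m))].
rewrite sub0r normrN; apply: le_trans; apply: (le_trans (bound m)).
exact: ler_norm.
Qed.

End factor.

(** * Itineraries through the partition *)

Section names.
Context d (X : measurableType d) (R : realType) (mu : probability X R).
Context (T : X -> X) (Q : set (set X)).
Hypothesis mpT : measure_preserving mu T.
Hypothesis pQ : countable_measurable_partition Q.

Lemma partition_code : exists q : X -> nat,
  (forall x, Q (q @^-1` [set q x])) /\
  (forall B x, Q B -> B x -> B = q @^-1` [set q x]).
Proof.
case: pQ => cQ _ [covQ trivQ _].
have /choice[b Hb] : forall x, exists B, Q B /\ B x.
  by move=> x; have : [set: X] x by []; rewrite -covQ => -[B]; exists B.
have /countable_injP[e einj] := cQ.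
have bE B x : Q B -> B x -> B = b x.
  by move=> QB Bx; have [Qb bx] := Hb x; apply: trivQ => //; exists x.
have H x : b x = (e \o b) @^-1` [set (e \o b) x].
  apply/seteqP; split => y /=.
    by move=> bxy; rewrite -(bE _ _ (Hb x).1 bxy).
  move=> /einj <-; rewrite ?in_setE.
  - exact: (Hb y).2.
  - exact: (Hb y).1.
  - exact: (Hb x).1.
exists (e \o b); split => [x|B x QB Bx]; first by rewrite -H; exact: (Hb x).1.
by rewrite -H; exact: bE.
Qed.

Context (q : X -> nat).
Hypothesis qQ : forall x, Q (q @^-1` [set q x]).
Hypothesis Qq : forall B x, Q B -> B x -> B = q @^-1` [set q x].

(** The itinerary of [x] through the partition up to time [n], encoded as a
number: its fibres are the nonempty blocks of [join_preimages T Q n]. *)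
Definition itinerary (n : nat) (x : X) : nat :=
  pickle [seq q (iter i T x) | i <- iota 0 n].

Lemma itineraryP n x y :
  itinerary n x = itinerary n y <->
  forall i, (i < n)%N -> q (iter i T x) = q (iter i T y).
Proof.
split=> [/(pcan_inj (@pickleK _)) H i ni|H].
  have := congr1 (fun s => nth 0%N s i) H.
  by rewrite !(nth_map 0%N) ?size_iota// !nth_iota.
congr pickle; apply/eq_in_map => i.
by rewrite mem_iota add0n => /andP[_]; exact: H.
Qed.

Lemma refining_itinerary : refining itinerary.
Proof.
move=> m n x y mn /itineraryP H; apply/itineraryP => i im.
by apply: H; exact: leq_trans mn.
Qed.

Lemma cell_join n x : join_preimages T Q n (cell itinerary n x).
Proof.
exists (fun i => iter i T @^-1` (q @^-1` [set q (iter i T x)])).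
  by move=> i _; exists (q @^-1` [set q (iter i T x)]).
apply/seteqP; split => y /= H; first by apply/itineraryP => i ni; exact: H.
by move=> i ni /=; move: i ni; apply/itineraryP.
Qed.

(** A block of [join_preimages] given by an arbitrary choice of preimages is
empty or a single cell; in both cases it is saturated. *)
Lemma join_saturated n A x y : join_preimages T Q n A ->
  itinerary n x = itinerary n y -> A x -> A y.
Proof.
move=> [B HB <-] /itineraryP xy Ax i ni.
have [C QC E] := HB _ ni; move: (Ax _ ni); rewrite -E /= => Cx.
by rewrite (Qq QC Cx)/= xy.
Qed.

Lemma measurable_code j : measurable (q @^-1` [set j]).
Proof.
have [[x <-]|nj] := pselect (exists x, q x = j).
  by case: pQ => _ mQ _; apply: mQ; exact: qQ.
rewrite (_ : _ @^-1` _ = set0)//; apply/seteqP; split => // x qx.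
by apply: nj; exists x.
Qed.

Lemma measurable_itinerary n j : measurable (itinerary n @^-1` [set j]).
Proof.
have [[x <-]|nj] := pselect (exists x, itinerary n x = j); last first.
  rewrite (_ : _ @^-1` _ = set0)//; apply/seteqP; split => // x qx.
  by apply: nj; exists x.
rewrite (_ : _ @^-1` _ =
    \bigcap_(i in `I_n) (iter i T @^-1` (q @^-1` [set q (iter i T x)]))).
  apply: bigcap_measurableType => i _.
  rewrite -[X in measurable X]setTI; apply: (measurable_iter mpT) => //.
  exact: measurable_code.
apply/seteqP; split => y /= H; last by apply/itineraryP => i ni; exact: H.
by move=> i ni /=; move: i ni; apply/itineraryP.
Qed.

Lemma join_sigma_saturated n A x y : <<s join_preimages T Q n >> A ->
  itinerary n x = itinerary n y -> A x -> A y.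
Proof.
move=> sA; suff : forall x y, itinerary n x = itinerary n y -> (A x <-> A y).
  by move=> /[apply] ->.
apply: (smallest_sub (X := [set A | forall x y,
  itinerary n x = itinerary n y -> (A x <-> A y)])) sA; last first.
  by move=> B jB u v uv; split; apply: (join_saturated jB).
split.
- by [].
- move=> B HB u v uv; rewrite !setTD /setC/=.
  by split => h Bu; apply: h; apply/(HB u v uv).
- move=> F HF u v uv.
  by split => -[i _ Fi]; exists i => //; apply/(HF i u v uv).
Qed.

Lemma saturated_join_sigma n A :
  (forall x y, itinerary n x = itinerary n y -> A x -> A y) ->
  <<s join_preimages T Q n >> A.
Proof.
move=> sA; rewrite (saturatedE sA).
apply: (sigma_bigcup (smallest_sigma_algebra _ _)) => j.
case: asboolP => [[x _ <-]|_].
  by apply: sub_sigma_algebra; exact: cell_join.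
by case: (smallest_sigma_algebra setT (join_preimages T Q n)).
Qed.

Let PP := partition_sigma_algebra T Q.

Lemma sigma_algebra_partition : sigma_algebra setT PP.
Proof. exact: smallest_sigma_algebra. Qed.

(** For [n = 0] the generator is outside the union that defines the partition
sigma-algebra, but it is trivial: all points have the same itinerary. *)
Lemma join_sub_partition n : <<s join_preimages T Q n >> `<=` PP.
Proof.
case: n => [|n]; last first.
  by apply: sub_sigma_algebra2 => A jA; exists n.+1.
move=> A /join_sigma_saturated sA.
have [[x Ax]|nA] := pselect (exists x, A x).
  rewrite (_ : A = ~` set0).
    by apply: (sigma_setC sigma_algebra_partition);
      case: sigma_algebra_partition.
  rewrite setC0; apply/seteqP; split => // y _.
  by apply: sA Ax; exact/itineraryP.
rewrite (_ : A = set0); first by case: sigma_algebra_partition.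
by apply/seteqP; split => // x Ax; apply: nA; exists x.
Qed.

Lemma partition_cell n x : PP (cell itinerary n x).
Proof.
by apply: (@join_sub_partition n); apply: sub_sigma_algebra; exact: cell_join.
Qed.

Lemma partition_sub_cells : PP `<=` <<s cell_algebra itinerary >>.
Proof.
apply: sub_sigma_algebra2 => A [n _ jA]; exists n, (itinerary n @` A).
apply/seteqP; split => x; first by exists x.
by move=> [y Ay yx]; apply: (join_saturated jA yx).
Qed.

Lemma partition_measurable : PP `<=` measurable.
Proof.
apply: smallest_sub; first exact: sigma_algebra_measurable.
move=> A [n _ jA]; apply: (saturated_measurable (measurable_itinerary n)).
by move=> x y; exact: join_saturated.
Qed.

(** The preimage of a block of level [n] leaves the first letter of the
itinerary free, so it is a union of blocks of level [n.+1]. *)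
Lemma partition_preimage A : PP A -> PP (T @^-1` A).
Proof.
apply: (smallest_sub (X := [set A | PP (T @^-1` A)])).
  split => /=.
  - by rewrite preimage_set0; case: sigma_algebra_partition.
  - move=> B HB; rewrite setTD preimage_setC.
    exact: (sigma_setC sigma_algebra_partition).
  - move=> F HF; rewrite preimage_bigcup.
    exact: (sigma_bigcup sigma_algebra_partition).
move=> B [n _ jB] /=; apply: (@join_sub_partition n.+1).
apply: saturated_join_sigma => x y /itineraryP xy; apply: (join_saturated jB).
by apply/itineraryP => i ni; rewrite -!iterSr; exact: xy.
Qed.

End names.

(** * Joint convergence *)

Section assembly.
Context d (X : measurableType d) (R : realType) (mu : probability X R).

(** For fixed [j] the exceptional points lie, for every [N], in a set whose
measure is at most [j.+1] times the integral of [M_ N]. *)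
Lemma uniformly_small_means (a : nat -> X -> nat) (M_ : nat -> X -> \bar R) :
  (forall n j, measurable (a n @^-1` [set j])) -> refining a ->
  (forall N, measurable_fun setT (M_ N)) -> (forall N x, 0 <= M_ N x)%E ->
  (\int[mu]_x M_ N x)%E @[N --> \oo] --> 0%E ->
  {ae mu, forall x, forall j : nat, exists N, forall n,
    (\int[mu]_(y in cell a n x) M_ N y <= (j.+1%:R^-1)%:E * mu (cell a n x))%E}.
Proof.
move=> ma ra mM M0 M_0; apply/ae_foralln => j.
apply: negligible_small => e e0.
set c : R := _^-1; have c0 : 0 < c by rewrite invr_gt0.
have ce0 : 0 < c * e by rewrite mulr_gt0.
have [N _ HN] : \forall N \near \oo, (\int[mu]_x M_ N x < (c * e)%:E)%E.
  apply: (M_0 [set u | (u < (c * e)%:E)%E]).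
  by apply: open_ereal_lt'; rewrite lte_fin.
have [mE HE] := cell_maximal mu ma ra (mM N) (M0 N) (ltW c0).
set E := [set x | _] in mE HE; exists E; split => //.
  move=> x /= nx; apply: contrapT => nE; apply: nx; exists N => n.
  by rewrite leNgt; apply/negP => h; apply: nE; exists n.
rewrite -(@lee_pmul2l _ c%:E)// (le_trans HE)// -EFinM ltW//.
exact: HN (leqnn N).
Qed.

(** The sets of [G] do not separate points of a cell, so [h] is constant on
it. *)
Lemma cond_exp_cell_mean (a : nat -> X -> nat) (G : set (set X)) (n : nat)
    (phi h : X -> R) (x : X) :
  (forall y, measurable (cell a n y)) ->
  (forall A y z, G A -> a n y = a n z -> A y -> A z) -> G (cell a n x) ->
  is_cond_exp mu G phi h -> 0 < fine (mu (cell a n x)) ->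
  h x = cell_mean mu a n phi x.
Proof.
move=> mc sG Gc [mh ih Eh] x0; rewrite /cell_mean /Rintegral -(Eh _ Gc).
have -> : (\int[mu]_(y in cell a n x) (h y)%:E =
    \int[mu]_(y in cell a n x) (cst (h x) y)%:E)%E.
  apply: eq_integral => y; rewrite in_setE => yx; congr (_%:E).
  exact: (sG _ x y (mh [set h x] (measurable_set1 _)) (esym yx) erefl).
rewrite -/(Rintegral mu (cell a n x) (cst (h x))) Rintegral_cst//.
by rewrite mulfK// gt_eqF.
Qed.

End assembly.

Theorem theorem1 (R : realType) (d : measure_display) (X : measurableType d)
  (mu : probability X R) (T : X -> X) (Q : set (set X)) (p : \bar R)
  (f : X -> R) (h : nat -> nat -> X -> R) (g : X -> R) :
  measure_preserving mu T ->
  countable_measurable_partition Q ->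
  (1 < p)%E ->
  f \in Lfun mu p ->
  (forall n k : nat,
    is_cond_exp mu <<s join_preimages T Q n >> (time_average T f k) (h n k)) ->
  is_cond_exp mu (invariant_sets T `&` partition_sigma_algebra T Q) f g ->
  {ae mu, forall x : X, h nk.1 nk.2 x @[nk --> (\oo, \oo)] --> g x}.
Proof.
move=> mpT pQ p1 fp Hh Hg.
have [r r1 [iff ifr]] := Lfun_gt1 p1 fp.
have iM := integrable_max_average mpT r1 iff ifr.
have [q [qQ Qq]] := partition_code pQ.
pose a := itinerary T q.
have ma n j : measurable (a n @^-1` [set j]).
  exact: (measurable_itinerary mpT pQ qQ).
have ra : refining a by exact: refining_itinerary.
pose PP := partition_sigma_algebra T Q.
have [gm ig Eg] := Hg.
(* singletons are measurable, so the invariance of [g] is exact *)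
have gT x : g (T x) = g x.
  have [[_ gx] _] := gm [set g x] (measurable_set1 _).
  by have : (T @^-1` (g @^-1` [set g x])) x by rewrite gx.
pose F := birkhoff_limit T f.
have [iF EF] := birkhoff_limit_dominated mpT iff iM.
have FT : {ae mu, forall x, F (T x) = F x} by exact: birkhoff_limit_invariant.
have f_F := birkhoff_limit_ae mpT iff.
(* the conditional expectation of [F] on [PP] is [g] *)
have EFg B :
    PP B -> (\int[mu]_(x in B) (F x)%:E = \int[mu]_(x in B) (g x)%:E)%E.
  move=> PB; have mPP := partition_measurable mpT pQ qQ Qq.
  have iFg (D : set X) : measurable D ->
      mu.-integrable D (EFin \o F) /\ mu.-integrable D (EFin \o g).
    by move=> mD; split; [exact: integrableS iF|exact: integrableS ig].
  have iH : mu.-integrable setT (EFin \o (fun x => F x - g x)).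
    exact: (@integrableB _ _ _ mu setT measurableT _ _ iF ig).
  have HT : {ae mu, forall x, F (T x) - g (T x) = F x - g x}.
    by apply: filterS FT => x ->; rewrite gT.
  have := @invariant_integral0 _ _ _ _ _ mpT PP
    (sigma_algebra_partition T Q) mPP
    (@partition_preimage _ _ T Q q qQ Qq) _ iH HT _ B PB.
  have mB := mPP _ PB; have [iFB igB] := iFg _ mB.
  rewrite (integralB_EFin mB iFB igB) => H0.
  suff : ((\int[mu]_(x in B) (F x)%:E) - \int[mu]_(x in B) (g x)%:E = 0)%E.
    rewrite -(fineK (integrable_fin_num mB iFB)).
    rewrite -(fineK (integrable_fin_num mB igB)).
    by rewrite -EFinB => -[/eqP]; rewrite subr_eq0 => /eqP ->.
  apply: H0 => Z PZ TZ; have mZ := mPP _ PZ; have [iFZ igZ] := iFg _ mZ.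
  rewrite (integralB_EFin mZ iFZ igZ) EF// Eg// subee//.
  apply: (integrable_fin_num mZ).
  exact: (integrableS measurableT mZ (@subsetT _ _) iff).
have resg : resolved mu a g.
  apply: (resolved_integrable ma ra ig) => B mB.
  by apply: (partition_sub_cells Qq); have [] := gm B mB.
pose M_ N x := esups (fun k => (`|time_average T f k x - F x|)%:E) N.
have iA k : mu.-integrable setT (EFin \o time_average T f k).
  exact: (integrable_time_average mpT).
have mA k : measurable_fun setT (time_average T f k).
  exact: L1_measurable (iA k).
have mF := L1_measurable iF.
have mM_ N : measurable_fun setT (M_ N).
  apply: measurable_fun_esups => k; apply/measurable_EFinP.
  by apply: measurableT_comp => //; exact: measurable_funB.
have M_ge N k x :
    (N <= k)%N -> ((`|time_average T f k x - F x|)%:E <= M_ N x)%E.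
  by move=> Nk; apply: ereal_sup_ubound; exists k.
have M_0 N x : (0 <= M_ N x)%E.
  by apply: le_trans (M_ge N N x (leqnn N)); rewrite lee_fin.
have M_cvg : (\int[mu]_x M_ N x)%E @[N --> \oo] --> 0%E.
  have [] // := @dominated_convergence _ _ _ mu setT measurableT M_ (cst 0%E)
    (fun x => max_average T f x + `|(F x)%:E|)%E.
  - apply: filterS f_F => x fx _.
    apply: (@cvg_esups _ (fun k => (`|time_average T f k x - F x|)%:E) 0%E).
    apply: cvg_EFin; first exact: nearW.
    apply/cvgrPdist_le => e e0; move/cvgrPdist_le : fx => /(_ _ e0).
    by apply: filterS => k; rewrite /= sub0r normrN normr_id distrC.
  - exact: (integrableD measurableT iM (integrable_abse iF)).
  - apply: aeW => x N _; rewrite gee0_abs//; apply: ub_ereal_sup => _ [k _ <-].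
    apply: (@le_trans _ _ (`|time_average T f k x|%:E + `|F x|%:E)%E).
      by rewrite -EFinD lee_fin ler_normB.
    by apply: leeD => //; exact: time_average_le_maxe.
  by move=> _ _; rewrite integral0.
have small := uniformly_small_means ma ra mM_ M_0 M_cvg.
have posc := cells_pos_ae mu ma.
apply: filterS3 posc resg small => x pos_x g_x small_x.
have hE n k : h n k x = cell_mean mu a n (time_average T f k) x.
  apply: (cond_exp_cell_mean _ _ _ (Hh n k)) => //.
  - by move=> y; exact: measurable_cell.
  - by move=> A y z; exact: join_sigma_saturated.
  - by apply: sub_sigma_algebra; exact: cell_join.
have FgE n : cell_mean mu a n F x = cell_mean mu a n g x.
  by rewrite /cell_mean /Rintegral EFg//; exact: partition_cell.
apply/cvgrPdist_le => e e0.
have e20 : 0 < e / 2 by rewrite divr_gt0.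
have [N1 _ HN1] := (cvgrPdist_le _ _).1 g_x _ e20.
have [j _ Hj] : \forall j \near \oo, (j.+1%:R^-1 < e / 2).
  by apply: (@near_infty_natSinv_lt _ (PosNum e20)).
have [N2 HN2] := small_x j.
exists ([set n | (N1 <= n)%N], [set k | (N2 <= k)%N]) => /=.
  by split; [exists N1|exists N2].
move=> [n k] /= [nN1 kN2]; rewrite hE.
have mc := measurable_cell ma n x.
pose D y := `|time_average T f k y - F y|.
have iD : mu.-integrable setT (EFin \o D) by exact: L1_norm_diff.
(* the mean of the error is at most that of [M_ N2] *)
have mean_small : cell_mean mu a n D x <= j.+1%:R^-1.
  rewrite leNgt; apply/negP => lt_mean.
  have j0 : 0 <= j.+1%:R^-1 :> R by rewrite invr_ge0.
  have := cell_mean_gt ma iD j0 lt_mean; rewrite ltNge => /negP; apply.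
  apply: le_trans (HN2 n).
  apply: ge0_le_integral => //.
  - by move=> y _; rewrite lee_fin normr_ge0.
  - by apply: measurable_funTS; case/integrableP : iD.
  - exact: measurable_funTS.
  - by move=> y _; exact: M_ge.
have diff : `|cell_mean mu a n F x -
    cell_mean mu a n (time_average T f k) x| <= e / 2.
  rewrite distrC -cell_meanB// (le_trans (cell_mean_norm ma n x _))//.
    exact: (@integrableB _ _ _ mu setT measurableT _ _ (iA k) iF).
  by rewrite (le_trans mean_small)// ltW// Hj/=.
have := HN1 n nN1; rewrite /= -FgE => g_close.
rewrite (_ : g x - _ = (g x - cell_mean mu a n F x) +
  (cell_mean mu a n F x - cell_mean mu a n (time_average T f k) x));
  last by ring.
by rewrite (le_trans (ler_normD _ _))// [e]splitr lerD.
Qed.
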